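(* Put $$\Lambda_1=\sum_{i=2}^\infty (i-1)p_i\,\frac{\partial}{\partial p_{i-1}},\qquad M_1=\sum_{i=2}^\infty \sum_{j=1}^{i-1} \left((i-1)p_j p_{i-j}\,\frac{\partial}{\partial p_{i-1}}+ j(i-j) p_{i+1}\,\frac{\partial^2}{\partial p_j\, \partial p_{i-j}}\right).$$ Let $F=F(s,u,v,p_1,p_2,\dots)$ be the generating function of the numbers $N_{k,l}(\mu)$ of dessins d'enfants. Then $e^F$ satisfies the evolution equation $$\frac{\partial e^F}{\partial s}=\bigl((u+v)\Lambda_1+M_1+uvp_1\bigr)e^F,$$ and is uniquely determined by it together with the initial condition $F|_{s=0}=0$. In other words, $$e^F=e^{s((u+v)\Lambda_1+M_1+uvp_1)}\,1,$$ where $1$ is the constant function identically equal to $1$ and $e^{sA}1=\sum_{n\ge0}\frac{s^n}{n!}A^n1$.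
   Context: A Belyi pair $(C,f)$ is a smooth compact connected complex algebraic curve $C$ together with a non-constant meromorphic function $f:C\to\mathbb{C}P^1$ unramified over $\mathbb{C}P^1\setminus\{0,1,\infty\}$. For positive integers $k,l,m$ and $\mu=(\mu_1,\dots,\mu_m)\in\mathbb{Z}_{>0}^m$, let $\mathcal{D}_{k,l;\mu}$ be the set of isomorphism classes of Belyi pairs with $|f^{-1}(0)|=k$, $|f^{-1}(1)|=l$ (numbers of distinct points), whose $m$ poles are labeled $1,\dots,m$, the $i$-th pole having order $\mu_i$. Isomorphisms are isomorphisms of curves commuting with the maps $f$ and preserving the labels of the poles. (Equivalently, $\mathcal{D}_{k,l;\mu}$ is the set of connected bicolored ribbon graphs (dessins) $\Gamma=f^{-1}([0,1])$ with $k$ white vertices, $l$ black vertices, $d=\sum_i\mu_i$ edges and $m$ labeled boundary components.) Put $$N_{k,l}(\mu)=\sum_{\Gamma\in\mathcal{D}_{k,l;\mu}}\frac1{|\mathrm{Aut}_b\Gamma|},$$ where $\mathrm{Aut}_b\Gamma$ is the (finite) group of automorphisms preserving each boundary component (i.e. each pole). The generating function is $$F(s,u,v,p_1,p_2,\dots)=\sum_{k,l,m\ge1}\frac1{m!}\sum_{\mu\in\mathbb{Z}_{>0}^m}N_{k,l}(\mu)\,s^{d}u^kv^l\,p_{\mu_1}\cdots p_{\mu_m},\qquad d=\sum_{i=1}^m\mu_i,$$ an element of $\mathbb{Q}[u,v,p_1,p_2,\dots][[s]]$. *)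

(* Defs.v *)
From HB Require Import structures.
From mathcomp Require Import all_boot all_order all_algebra all_fingroup.
From mathcomp Require Import finmap monalg zify.

Set Implicit Arguments.
Unset Strict Implicit.
Unset Printing Implicit Defensive.

Import GRing.Theory Num.Theory.

Local Open Scope ring_scope.

(** * Dessins d'enfants

   A dessin with d edges is given, on the edge set 'I_d, by the permutations
   [w] and [b] turning every edge to the next one around its white, resp.
   black, endpoint.  White (black) vertices are the cycles of w (of b), i.e.
   the points over 0 (over 1); boundary components are the cycles of w * b,
   i.e. the poles, a cycle of length r being a pole of order r (its boundary
   consists of 2r edge sides).  [lab i] is the boundary component labelled i.
   The edge set being fixed, this is a dessin up to renaming of the edges, and
   isomorphism classes are taken below. *)

Definition dessin (m d : nat) : Type :=
  ('S_d * 'S_d * {ffun 'I_m -> {set 'I_d}})%type.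

HB.instance Definition _ m d := Finite.on (dessin m d).

Section Dessins.
Variables (m d : nat).
Implicit Types (G : dessin m d) (g : 'S_d).

Definition white G : 'S_d := G.1.1.
Definition black G : 'S_d := G.1.2.
Definition lab G : {ffun 'I_m -> {set 'I_d}} := G.2.

Definition connected G : bool :=
  [transitive <<[set white G; black G]>>%g, on [set: 'I_d] | 'P].

Definition is_dessin (k l : nat) (mu : 'I_m -> nat) G : bool :=
  [&& connected G,
      #|porbits (white G)| == k,
      #|porbits (black G)| == l,
      injectiveb (lab G),
      [set lab G i | i : 'I_m] == porbits (white G * black G)%g
    & [forall i, #|lab G i| == mu i]].

Definition iso_by g G G' : bool :=
  [&& [forall x, g (white G x) == white G' (g x)],
      [forall x, g (black G x) == black G' (g x)]
    & [forall i, lab G' i == g @: lab G i]].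

Definition iso G G' : bool := [exists g, iso_by g G G'].

(* Aut_b: colour-preserving automorphisms fixing every boundary component. *)
Definition aut G : {set 'S_d} := [set g | iso_by g G G].

Lemma iso_by1 G : iso_by 1%g G G.
Proof.
apply/and3P; split; apply/forallP=> x; rewrite ?perm1 //.
rewrite (eq_imset (lab G x) (perm1 (T:='I_d))) imset_id //.
Qed.

Lemma iso_byM g h G1 G2 G3 :
  iso_by g G1 G2 -> iso_by h G2 G3 -> iso_by (g * h)%g G1 G3.
Proof.
move=> /and3P[/forallP w1 /forallP b1 /forallP l1].
move=> /and3P[/forallP w2 /forallP b2 /forallP l2].
apply/and3P; split; apply/forallP=> x.
- by rewrite !permM (eqP (w1 x)) (eqP (w2 _)).
- by rewrite !permM (eqP (b1 x)) (eqP (b2 _)).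
- rewrite (eqP (l2 x)) (eqP (l1 x)) -imset_comp.
  by apply/eqP/eq_imset=> y; rewrite /= permM.
Qed.

Lemma iso_byV g G1 G2 : iso_by g G1 G2 -> iso_by g^-1%g G2 G1.
Proof.
move=> /and3P[/forallP w1 /forallP b1 /forallP l1].
apply/and3P; split; apply/forallP=> x.
- by rewrite -{1}(permKV g x) -(eqP (w1 _)) permK.
- by rewrite -{1}(permKV g x) -(eqP (b1 _)) permK.
- rewrite (eqP (l1 x)) -imset_comp; apply/eqP.
  rewrite -[LHS]imset_id; apply: eq_imset=> y /=; by rewrite permK.
Qed.

Lemma aut_group_set G : group_set (aut G).
Proof.
apply/group_setP; split; first by rewrite inE iso_by1.
by move=> g h; rewrite !inE; apply: iso_byM.
Qed.

Lemma iso_equivalence : equivalence_rel iso.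
Proof.
apply/equivalence_relP; split=> [G|G1 G2 /existsP[g g12] G3].
  by apply/existsP; exists 1%g; apply: iso_by1.
apply/existsP/existsP=> -[h hG].
  by exists (g^-1 * h)%g; apply: iso_byM hG; apply: iso_byV.
by exists (g * h)%g; apply: iso_byM hG.
Qed.

End Dessins.

(* One term per isomorphism class. *)
Definition N (m k l : nat) (mu : 'I_m -> nat) : rat :=
  let D := [set G : dessin m (\sum_i mu i)%N | is_dessin k l mu G] in
  \sum_(G in transversal (equivalence_partition (@iso m _) D) D)
     (#|aut G|%:R)^-1.

Lemma card_porbits_le d (s : 'S_d) : (#|porbits s| <= d)%N.
Proof. by rewrite -[X in (_ <= X)%N]card_ord leq_imset_card. Qed.

Lemma N_eq0 (m k l : nat) (mu : 'I_m -> nat) :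
  (\sum_i mu i < k)%N || (\sum_i mu i < l)%N -> N k l mu = 0.
Proof.
move=> hkl; rewrite /N; set D := [set _ | _].
have D0 : D = set0.
  apply/setP=> G; rewrite !inE; apply/negP=> /and5P[_ /eqP kE /eqP lE _ _].
  by move: hkl; rewrite -kE -lE !ltnNge !card_porbits_le.
have /transversalP h : partition (equivalence_partition (@iso m _) D) D.
  by apply: equivalence_partitionP => G1 G2 G3 _ _ _; apply: iso_equivalence.
rewrite big1 // => G /(subsetP (transversal_sub h)).
by rewrite -/D D0 inE.
Qed.

(** * The ring Q[u, v, p_1, p_2, ...] *)

(* [inl false] is u, [inl true] is v and [inr i] is p_{i+1}. *)
Definition var : Type := (bool + nat)%type.
HB.instance Definition _ := Choice.on var.

Notation malgQ := {malg rat[{cmonom var}]}.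

(* The algebra [malgQ], with product and scaling sealed: unification would
   otherwise unfold them down to the coefficients and diverge. *)
Definition Qup : Type := malgQ.
HB.instance Definition _ := GRing.Zmodule.on Qup.

HB.lock Definition Qup_mul (f g : Qup) : Qup := (f : malgQ) * (g : malgQ).

Lemma Qup_mulA : associative Qup_mul.
Proof. by move=> f g h; rewrite Qup_mul.unlock; apply: (@mulrA malgQ). Qed.

Lemma Qup_mulC : commutative Qup_mul.
Proof. by move=> f g; rewrite Qup_mul.unlock; apply: (@mulrC malgQ). Qed.

Lemma Qup_mul1 : left_id (1 : malgQ) Qup_mul.
Proof. by move=> f; rewrite Qup_mul.unlock; apply: (@mul1r malgQ). Qed.

Lemma Qup_mulDl : left_distributive Qup_mul +%R.
Proof. by move=> f g h; rewrite Qup_mul.unlock; apply: (@mulrDl malgQ). Qed.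

Lemma Qup_oner_neq0 : (1 : malgQ) != (0 : Qup).
Proof. exact: (@oner_neq0 malgQ). Qed.

HB.instance Definition _ := GRing.Zmodule_isComNzRing.Build Qup
  Qup_mulA Qup_mulC Qup_mul1 Qup_mulDl Qup_oner_neq0.

HB.lock Definition Qup_scale (c : rat) (f : Qup) : Qup := c *: (f : malgQ).

Lemma Qup_scaleA (a b : rat) (f : Qup) :
  Qup_scale a (Qup_scale b f) = Qup_scale (a * b) f.
Proof. by rewrite Qup_scale.unlock; apply: (@scalerA rat malgQ). Qed.

Lemma Qup_scale1 : left_id 1 Qup_scale.
Proof. by move=> f; rewrite Qup_scale.unlock; apply: (@scale1r rat malgQ). Qed.

Lemma Qup_scaleDr : right_distributive Qup_scale +%R.
Proof. by move=> c f g; rewrite Qup_scale.unlock; apply: (@scalerDr rat malgQ). Qed.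

Lemma Qup_scaleDl (f : Qup) : {morph Qup_scale^~ f : a b / a + b}.
Proof. by move=> a b; rewrite Qup_scale.unlock; apply: (@scalerDl rat malgQ). Qed.

HB.instance Definition _ := GRing.Zmodule_isLmodule.Build rat Qup
  Qup_scaleA Qup_scale1 Qup_scaleDr Qup_scaleDl.

Lemma Qup_scaleAl (c : rat) (f g : Qup) :
  Qup_scale c (Qup_mul f g) = Qup_mul (Qup_scale c f) g.
Proof.
by rewrite Qup_mul.unlock Qup_scale.unlock; apply: (@scalerAl rat malgQ).
Qed.

HB.instance Definition _ := GRing.Lmodule_isLalgebra.Build rat Qup Qup_scaleAl.
HB.instance Definition _ := GRing.Lalgebra_isComAlgebra.Build rat Qup.

Lemma Qup_mulE (f g : Qup) : f * g = (f : malgQ) * (g : malgQ).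
Proof. by transitivity (Qup_mul f g); rewrite // Qup_mul.unlock. Qed.

Lemma Qup_scaleE (c : rat) (f : Qup) : c *: f = c *: (f : malgQ).
Proof. by transitivity (Qup_scale c f); rewrite // Qup_scale.unlock. Qed.

HB.lock Definition X (x : var) : Qup := << ucm x >>.

Definition u : Qup := X (inl false).
Definition v : Qup := X (inl true).

(* Indices start at 1: [p 0] and [dp 0] are junk values, never used below. *)
Definition p (i : nat) : Qup := X (inr i.-1).

HB.lock Definition pderiv (x : var) (f : Qup) : Qup :=
  \sum_(t <- msupp f) << f@_t *+ t x *g divcm t (ucm x) >>.

Definition dp (i : nat) : Qup -> Qup := pderiv (inr i.-1).

(* The largest i such that p_i occurs in f (0 if there is none). *)
Definition pindex (f : Qup) : nat :=
  \max_(t <- msupp f) \max_(x <- finsupp t) (if x is inr i then i.+1 else 0%N).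

Lemma mcoeff_pderiv (x : var) (f : Qup) (t : {cmonom var}) :
  (pderiv x f)@_t = f@_(mmul t (ucm x)) *+ (t x).+1.
Proof.
rewrite pderiv.unlock raddf_sum /=; set t' := mmul t _.
have t'x : t' x = (t x).+1 by rewrite /t' cmM cmU eqxx addn1.
have divK (m : {cmonom var}) : (0 < m x)%N -> mmul (divcm m (ucm x)) (ucm x) = m.
  move=> mx; apply/eqP/cmP=> y; rewrite cmM divcmE cmU.
  by case: eqP => [<-|_]; rewrite ?subnK // subn0 addn0.
have t'K : divcm t' (ucm x) = t.
  by apply/eqP/cmP=> y; rewrite divcmE cmM cmU addnK.
transitivity (\sum_(m <- msupp f) if m == t' then f@_t' *+ t' x else 0).
  apply: eq_bigr => m _; rewrite mcoeffU; have [->|mt'] := eqVneq m t'.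
    by rewrite t'K eqxx.
  case: eqP => [mE|]; last by rewrite mulr0n.
  have [mx0|mx] := posnP (m x); first by rewrite mx0 mulr0n mul0rn.
  by case/eqP: mt'; rewrite /t' -mE divK.
have [tf|tf] := boolP (t' \in msupp f).
  rewrite (bigD1_seq t' tf (fset_uniq _)) /= eqxx t'x big1 ?addr0 // => m.
  by move=> /negPf ->.
rewrite (mcoeff_outdom tf) !mul0rn big1 // => m _.
by case: ifP.
Qed.

Lemma mcoeff_pindex (i : nat) (f : Qup) (t : {cmonom var}) :
  (pindex f <= i)%N -> t (inr i) != 0%N -> f@_t = 0.
Proof.
move=> fi; rewrite cmE_neq0 => it; apply/eqP.
rewrite mcoeff_eq0; apply/negP=> tf.
have : (i.+1 <= pindex f)%N.
  rewrite /pindex (big_rem t) //= leq_max (big_rem (inr i : var)) //=.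
  by rewrite leq_max leqnn.
by rewrite leqNgt ltnS fi.
Qed.

Lemma dp_eq0 (i : nat) (f : Qup) : (pindex f < i)%N -> dp i f = 0.
Proof.
case: i => // i fi; apply/malgP=> t; rewrite mcoeff_pderiv mcoeff0.
by rewrite (mcoeff_pindex fi) ?mul0rn // cmM cmU eqxx addn1.
Qed.

Lemma dp_dp_eq0 (i j : nat) (f : Qup) :
  (pindex f < i)%N || (pindex f < j)%N -> dp i (dp j f) = 0.
Proof.
case/orP=> [|fj]; last first.
  by apply/malgP=> t; rewrite mcoeff_pderiv dp_eq0 // !mcoeff0 mul0rn.
case: i => // i fi; apply/malgP=> t; rewrite !mcoeff_pderiv mcoeff0.
by rewrite (mcoeff_pindex fi) ?mul0rn // !cmM cmU eqxx addn1 addSn.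
Qed.

(** * The operators

   The sums over i >= 2 are infinite, but on a given f only the terms with
   i < opbound f can be nonzero. *)

Definition Lambda1_term (i : nat) (f : Qup) : Qup :=
  (i.-1)%:R * p i * dp i.-1 f.

Definition M1_term (i : nat) (f : Qup) : Qup :=
  \sum_(1 <= j < i)
     ((i.-1)%:R * p j * p (i - j) * dp i.-1 f
      + (j * (i - j))%:R * p i.+1 * dp j (dp (i - j) f)).

Definition opbound (f : Qup) : nat := (pindex f).*2.+2.

Definition Lambda1 (f : Qup) : Qup := \sum_(2 <= i < opbound f) Lambda1_term i f.

Definition M1 (f : Qup) : Qup := \sum_(2 <= i < opbound f) M1_term i f.

Definition evol (f : Qup) : Qup := (u + v) * Lambda1 f + M1 f + u * v * p 1 * f.

Lemma Lambda1_term_eq0 (i : nat) (f : Qup) :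
  (opbound f <= i)%N -> Lambda1_term i f = 0.
Proof.
move=> fi; rewrite /Lambda1_term dp_eq0 ?mulr0 //.
move: fi; case: i => // i; rewrite ltnS; apply: leq_trans.
by rewrite ltnS -addnn leq_addr.
Qed.

Lemma M1_term_eq0 (i : nat) (f : Qup) : (opbound f <= i)%N -> M1_term i f = 0.
Proof.
rewrite /opbound -addnn => fi; rewrite /M1_term big_nat big1 // => j /andP[j0 ji].
have fi1 : (pindex f < i.-1)%N by lia.
have fj : (pindex f < j)%N || (pindex f < i - j)%N by apply/orP; lia.
rewrite (dp_eq0 fi1).
by rewrite (dp_dp_eq0 fj) !mulr0 addr0.
Qed.

Lemma Lambda1E (n : nat) (f : Qup) : (opbound f <= n)%N ->
  Lambda1 f = \sum_(2 <= i < n) Lambda1_term i f.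
Proof.
move=> fn; rewrite (big_cat_nat _ fn) //= [X in _ + X]big_nat.
by rewrite [X in _ + X]big1 ?addr0 // => i /andP[fi _]; rewrite Lambda1_term_eq0.
Qed.

Lemma M1E (n : nat) (f : Qup) : (opbound f <= n)%N ->
  M1 f = \sum_(2 <= i < n) M1_term i f.
Proof.
move=> fn; rewrite (big_cat_nat _ fn) //= [X in _ + X]big_nat.
by rewrite [X in _ + X]big1 ?addr0 // => i /andP[fi _]; rewrite M1_term_eq0.
Qed.

(** * Power series in s over Q[u, v, p_1, p_2, ...]

   A series is its sequence of coefficients. *)

Definition series : Type := nat -> Qup.

Definition sone : series := fun n => (n == 0%N)%:R.

Definition smul (f g : series) : series :=
  fun n => \sum_(i < n.+1) f i * g (n - i)%N.

Definition spow (f : series) (j : nat) : series := iter j (smul f) sone.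

(* The exponential of a series without constant term: f^j starts at s^j, so
   only the terms j <= n contribute to the coefficient of s^n. *)
Definition sexp (f : series) : series :=
  fun n => \sum_(j < n.+1) (j`!%:R : rat)^-1 *: spow f j n.

Definition sderiv (f : series) : series := fun n => n.+1%:R * f n.+1.

(* e^{sB} 1 *)
Definition sexp_op (B : Qup -> Qup) : series :=
  fun n => (n`!%:R : rat)^-1 *: iter n B 1.

(* The coefficient of s^d involves only k, l, m <= d: N vanishes if k > d or
   l > d by [N_eq0], and mu has m positive entries adding up to d. *)
Definition F : series := fun d =>
  \sum_(1 <= k < d.+1) \sum_(1 <= l < d.+1) \sum_(1 <= m < d.+1)
    (m`!%:R : rat)^-1 *:
      \sum_(mu : {ffun 'I_m -> 'I_d.+1}
             | [forall i, (0 < mu i)%N] && ((\sum_i mu i)%N == d))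
        N k l (fun i => mu i) *: (u ^+ k * v ^+ l * \prod_i p (mu i)).

(* Main.v *)
(* A dessin with d edges is a pair (w, b) of permutations of the edges.  By
   orbit counting, d! F_d is the sum over the pairs acting transitively of
   u^(cycles of w) v^(cycles of b) p_(cycle type of w b), the m! labellings of
   the poles cancelling the factor 1/m!.  Splitting off the component of a
   given edge shows that d! [s^d] e^F is the same sum W_d over all pairs
   (exponential formula, in the form (e^F)' = F' e^F).

   For the evolution equation, a permutation of d + 1 points is uniquely w t
   with w a permutation of d points and t either 1 or a transposition (y x)
   moving the new point x, and also uniquely t b.  For the pairs (w t, t' b) the
   product w t t' b is conjugate to (b w) t t'.  When t = t' = 1 this is a new
   fixed point (u v p_1); when one of them is 1, x is inserted in a cycle
   (Lambda_1); otherwise x is inserted in a cycle and then that cycle is cut or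
   joined with another one (the two parts of M_1). *)
Require Import Defs.
From mathcomp Require Import all_boot all_order all_algebra all_fingroup.
From mathcomp Require Import finmap monalg zify.

Set Implicit Arguments.
Unset Strict Implicit.
Unset Printing Implicit Defensive.

Import GRing.Theory Num.Theory Defs.

Local Open Scope ring_scope.

(** * Cycles and transpositions *)

Section CycleWeight.
Variable T : finType.
Implicit Types (s t : {perm T}) (A B : {set T}) (x y z : T).

Definition stable s A := forall z, z \in A -> s z \in A.

Lemma perm_on_stable A s : perm_on A s -> stable s A.
Proof. by move=> As z; rewrite perm_closed. Qed.

Lemma stable_expg s A n : stable s A -> stable (s ^+ n)%g A.
Proof.
move=> sA z zA; elim: n => [|n IH]; first by rewrite expg0 perm1.
by rewrite expgSr permM sA.
Qed.

Lemma stable_porbit s A x : stable s A -> x \in A -> porbit s x \subset A.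
Proof.
by move=> sA xA; apply/subsetP=> _ /porbitP[i ->]; apply: stable_expg xA.
Qed.

Lemma porbit_stable s x : stable s (porbit s x).
Proof. by move=> z; rewrite -!eq_porbit_mem (porbit_perm s 1 z). Qed.

(** On a finite type the preimage of a point lies on its forward orbit, so forward invariance is
    enough. *)
Lemma stableV s A : stable s A -> stable s^-1%g A.
Proof.
move=> sA z zA; have /subsetP := stable_porbit sA zA; apply.
by rewrite -porbitV (mem_porbit _ 1).
Qed.

Lemma stableD s A B : stable s A -> stable s B -> stable s (A :\: B).
Proof.
move=> sA sB z; rewrite !inE => /andP[zB zA]; rewrite sA // andbT.
by apply: contra zB => /(stableV sB); rewrite permK.
Qed.

Lemma stableU s A B : stable s A -> stable s B -> stable s (A :|: B).
Proof.
by move=> sA sB z; rewrite !inE => /orP[/sA->|/sB->]; rewrite ?orbT.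
Qed.

Lemma stableM s t A : stable s A -> stable t A -> stable (s * t)%g A.
Proof. by move=> sA tA z zA; rewrite permM tA ?sA. Qed.

Lemma stable_tperm x y A : x \in A -> y \in A -> stable (tperm x y) A.
Proof. by move=> xA yA z zA; case: tpermP. Qed.

Lemma eq_in_expg s t A x n : stable s A -> {in A, s =1 t} -> x \in A ->
  (s ^+ n)%g x = (t ^+ n)%g x.
Proof.
move=> sA st xA; elim: n => [|n IH]; first by rewrite !expg0.
by rewrite !expgSr !permM -IH st // stable_expg.
Qed.

Lemma eq_in_porbit s t A x : stable s A -> {in A, s =1 t} -> x \in A ->
  porbit s x = porbit t x.
Proof.
move=> sA st xA; apply/setP=> z; apply/porbitP/porbitP=> -[n ->]; exists n.
  exact: eq_in_expg st xA.
exact/esym/(eq_in_expg _ sA).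
Qed.

Lemma expg_porbit_inj s x i j : (i < #|porbit s x|)%N -> (j < #|porbit s x|)%N ->
  ((s ^+ i)%g x == (s ^+ j)%g x) = (i == j).
Proof.
move=> il jl; rewrite -(nth_uniq x _ _ (uniq_traject_porbit s x)) ?size_traject //.
by rewrite !nth_traject // !permX.
Qed.

Lemma expg_porbit_neq s x i : (0 < i < #|porbit s x|)%N -> (s ^+ i)%g x != x.
Proof.
case/andP=> i0 il; have := expg_porbit_inj (j := 0) il.
by rewrite expg0 perm1 lt0n card_porbit_neq0 (gtn_eqF i0) => /(_ isT) ->.
Qed.

Lemma card_porbit_return s x n : (0 < n)%N -> (s ^+ n)%g x = x ->
  (forall i, (0 < i < n)%N -> (s ^+ i)%g x != x) -> #|porbit s x| = n.
Proof.
move=> n0 sn si; apply/eqP; rewrite eqn_leq; apply/andP; split; last first.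
  rewrite leqNgt; apply/negP=> lt; have := si #|porbit s x|.
  by rewrite lt lt0n card_porbit_neq0 permX iter_porbit eqxx => /(_ isT).
rewrite leqNgt; apply/negP=> lt; have := expg_porbit_inj (i := n) (j := 0) lt.
by rewrite expg0 perm1 sn eqxx lt0n card_porbit_neq0 gtn_eqF // => /(_ isT).
Qed.

Lemma mem_porbit_lt s x y : y \in porbit s x ->
  exists2 i, (i < #|porbit s x|)%N & y = (s ^+ i)%g x.
Proof.
by rewrite porbit_traject => /trajectP[i il ->]; exists i; rewrite ?permX.
Qed.

Lemma sum_porbit (V : nmodType) (g : T -> V) s x :
  \sum_(z in porbit s x) g z = \sum_(0 <= i < #|porbit s x|) g ((s ^+ i)%g x).
Proof.
rewrite -(big_map (fun i => (s ^+ i)%g x) xpredT g).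
rewrite -[LHS]big_enum /=; apply: perm_big.
apply: uniq_perm; rewrite ?enum_uniq //.
  rewrite map_inj_in_uniq ?iota_uniq // => i j.
  rewrite !mem_index_iota /= => il jl /eqP.
  by rewrite expg_porbit_inj // => /eqP.
move=> z; rewrite mem_enum; apply/idP/mapP.
  by move=> /mem_porbit_lt[i il ->]; exists i; rewrite ?mem_index_iota.
by case=> i _ ->; rewrite mem_porbit.
Qed.

(** Products act from left to right, so from [x] the new permutation follows the [s]-cycle of [x]
    until the step that would close it, and that step lands on [y]. By symmetry the cycle of [y] is
    run through as well; conversely the union of the two cycles is stable. *)
Lemma porbit_merge s x y : x \notin porbit s y ->
  porbit (s * tperm x y)%g x = porbit s x :|: porbit s y.
Proof.
have half a b : a \notin porbit s b ->
    porbit s a \subset porbit (s * tperm a b)%g a /\ b \in porbit (s * tperm a b)%g a.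
  move=> ab; set s' := (s * _)%g; set l := #|porbit s a|.
  have l0 : (0 < l)%N by rewrite lt0n card_porbit_neq0.
  have E i : (i < l)%N -> (s' ^+ i)%g a = (s ^+ i)%g a.
    elim: i => [|i IH] il; first by rewrite !expg0.
    rewrite !expgSr !permM IH 1?ltnW // tpermD //.
      by rewrite eq_sym -permM -expgSr expg_porbit_neq.
    apply: contra ab => /eqP ->.
    by rewrite porbit_sym -permM -expgSr mem_porbit.
  split; first by apply/subsetP=> _ /mem_porbit_lt[i il ->]; rewrite -E ?mem_porbit.
  apply/porbitP; exists l; rewrite -(prednK l0) expgSr permM E ?prednK //.
  have -> : s' ((s ^+ l.-1)%g a) = tperm a b ((s ^+ l.-1.+1)%g a).
    by rewrite expgSr !permM.
  by rewrite prednK // permX iter_porbit tpermL.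
move=> xy; have [sx yx] := half _ _ xy.
have [|sy _] := half y x; first by rewrite porbit_sym.
apply/eqP; rewrite eqEsubset; apply/andP; split.
  apply: stable_porbit; last by rewrite inE porbit_id.
  apply: stableM; first by apply: stableU; apply: porbit_stable.
  by apply: stable_tperm; rewrite inE porbit_id ?orbT.
rewrite subUset sx; move: yx; rewrite -eq_porbit_mem => /eqP <-.
by rewrite tpermC.
Qed.

(** Before time [j] the orbit of [x] meets neither [x] again nor [s ^+ j] of [x], so the
    transposition is not felt. *)
Lemma expg_cut s x j i : (j < #|porbit s x|)%N -> (i < j)%N ->
  ((s * tperm x ((s ^+ j) x)) ^+ i)%g x = (s ^+ i)%g x.
Proof.
move=> jl; elim: i => [|i IH] ij; first by rewrite !expg0.
rewrite !expgSr !permM IH 1?ltnW // -(permM _ s) -expgSr.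
rewrite tpermD //; first by rewrite eq_sym expg_porbit_neq //= (ltn_trans ij jl).
rewrite expg_porbit_inj //; lia.
Qed.

(** At time [j] the transposition sends the orbit back to [x], and this is the first return. *)
Lemma card_porbit_cut s x j : (0 < j < #|porbit s x|)%N ->
  #|porbit (s * tperm x ((s ^+ j) x))%g x| = j.
Proof.
case/andP=> j0 jl; apply: card_porbit_return => // [|i ij].
  rewrite -{2}(prednK j0) expgSr permM expg_cut ?prednK //.
  by rewrite permM -(permM _ s) -expgSr prednK ?tpermR.
rewrite expg_cut //; last by case/andP: ij.
by rewrite expg_porbit_neq //; lia.
Qed.

Lemma porbit_cut_notin s x j : (0 < j < #|porbit s x|)%N ->
  (s ^+ j)%g x \notin porbit (s * tperm x ((s ^+ j) x))%g x.
Proof.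
move=> /[dup] jj /andP[j0 jl]; apply/negP=> /mem_porbit_lt[i].
rewrite card_porbit_cut // => ij; rewrite expg_cut // => /eqP.
rewrite expg_porbit_inj //; lia.
Qed.

(** * Cycle weights and how a transposition changes them *)

Variable R : comNzRingType.
Implicit Types f : nat -> R.

(** With [f = p] this is the monomial of the cycle type, with [f] constant a power counting cycles.
    Restricting to cycles inside [A] lets permutations of subsets be treated as permutations of one
    fixed [T], whose fixed points outside [A] carry no weight. *)
Definition cycle_weight f s A : R :=
  \prod_(o in porbits s | o \subset A) f #|o|.

Lemma mem_porbits s x : porbit s x \in porbits s.
Proof. exact: imset_f. Qed.

Lemma cycle_weight_split f s A B : stable s B -> B \subset A ->
  cycle_weight f s A = cycle_weight f s B * cycle_weight f s (A :\: B).
Proof.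
move=> sB BA; rewrite /cycle_weight (bigID (fun o : {set T} => o \subset B)) /=.
congr (_ * _); apply: eq_bigl => o; case: imsetP => //= -[x _ ->].
  by apply/andP/idP=> [[]|oB] //; split=> //; apply: subset_trans BA.
rewrite subsetD; congr (_ && _); apply/idP/idP; last first.
  apply: contraL => /subsetP /(_ _ (porbit_id s x)) xB.
  by apply/pred0Pn; exists x; rewrite /= porbit_id.
apply: contraR => /pred0Pn[z /=]; rewrite porbit_sym => /andP[xz zB].
apply: stable_porbit => //.
by apply: (subsetP (stable_porbit sB zB)).
Qed.

Lemma eq_in_cycle_weight f s t A : stable s A -> {in A, s =1 t} ->
  cycle_weight f s A = cycle_weight f t A.
Proof.
move=> sA st; apply: eq_bigl => o; apply/andP/andP=> -[/imsetP[x _ ->] oA].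
  have xA : x \in A by rewrite (subsetP oA) ?porbit_id.
  by rewrite {1}(eq_in_porbit sA st xA) mem_porbits.
have xA : x \in A by rewrite (subsetP oA) ?porbit_id.
by rewrite -{1}(eq_in_porbit sA st xA) mem_porbits.
Qed.

Lemma cycle_weight_porbit f s x :
  cycle_weight f s (porbit s x) = f #|porbit s x|.
Proof.
rewrite /cycle_weight (big_pred1 (porbit s x)) // => o /=.
apply/andP/eqP=> [[/imsetP[z _ ->]]|->]; last by rewrite mem_porbits.
move=> /subsetP/(_ _ (porbit_id s z)).
by rewrite -eq_porbit_mem => /eqP.
Qed.

Lemma cycle_weight0 f s : cycle_weight f s set0 = 1.
Proof.
rewrite /cycle_weight big_pred0 // => o.
apply/negP=> /andP[/imsetP[z _ ->]] /subsetP/(_ _ (porbit_id s z)).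
by rewrite inE.
Qed.

Lemma cycle_weightT f s : cycle_weight f s setT = \prod_(o in porbits s) f #|o|.
Proof. by apply: eq_bigl => o; rewrite subsetT andbT. Qed.

Lemma cycle_weight_cat f s t A B : stable s A -> stable t B -> B \subset A ->
    {in A :\: B, s =1 t} -> stable s B ->
  cycle_weight f t A = cycle_weight f t B * cycle_weight f s (A :\: B).
Proof.
move=> sA tB BA st sB; rewrite (cycle_weight_split f tB BA); congr (_ * _).
by apply/esym/eq_in_cycle_weight => //; apply: stableD.
Qed.

Lemma cycle_weight_merge f s x y A : stable s A -> x \in A -> y \in A ->
    x \notin porbit s y ->
  cycle_weight f (s * tperm x y)%g A =
  f (#|porbit s x| + #|porbit s y|)%N *
    cycle_weight f s (A :\: porbit s x :\: porbit s y).
Proof.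
move=> sA xA yA xy; rewrite setDDl.
have sU : stable s (porbit s x :|: porbit s y).
  by apply: stableU; apply: porbit_stable.
have dis : porbit s x :&: porbit s y = set0.
  apply/eqP/set0Pn=> -[z /setIP[]]; rewrite -!eq_porbit_mem => /eqP zx /eqP zy.
  by case/negP: xy; rewrite -eq_porbit_mem -zx zy.
rewrite (cycle_weight_cat f sA (B := porbit s x :|: porbit s y)) //.
- rewrite -(porbit_merge xy) cycle_weight_porbit (porbit_merge xy).
  by rewrite cardsU dis cards0 subn0.
- by rewrite -(porbit_merge xy); apply: porbit_stable.
- by rewrite subUset !stable_porbit.
move=> z; rewrite inE => /andP[zU _]; rewrite permM tpermD //.
  apply: contra zU => /eqP xE; rewrite inE porbit_sym xE.
  by rewrite (mem_porbit s 1).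
apply: contra zU => /eqP xE; rewrite inE orbC porbit_sym xE.
by rewrite (mem_porbit s 1).
Qed.

(** The transposition joins two points of one cycle at distance [j], which splits it into cycles of
    lengths [j] and [#|porbit s x| - j] and leaves the other cycles alone. *)
Lemma cycle_weight_cut f s x j A : stable s A -> x \in A ->
    (0 < j < #|porbit s x|)%N ->
  cycle_weight f (s * tperm x ((s ^+ j) x))%g A =
  f j * f (#|porbit s x| - j)%N * cycle_weight f s (A :\: porbit s x).
Proof.
move=> sA xA jl; set y := (s ^+ j)%g x; set t := (s * _)%g.
have yx : y \in porbit s x by rewrite mem_porbit.
have tO : stable t (porbit s x).
  by apply: stableM; [apply: porbit_stable | apply: stable_tperm; rewrite ?porbit_id].
have sO := porbit_stable (s := s) (x := x).
rewrite (cycle_weight_cat f sA tO) ?stable_porbit //; last first.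
  move=> z; rewrite inE => /andP[zO _]; rewrite permM tpermD //.
    apply: contra zO => /eqP xE; rewrite porbit_sym xE.
    by rewrite (mem_porbit s 1).
  apply: contra zO; rewrite -eq_porbit_mem in yx; rewrite -(eqP yx) => /eqP ->.
  by rewrite porbit_sym (mem_porbit s 1).
congr (_ * _).
have tx : porbit t x \subset porbit s x by apply: stable_porbit => //; apply: porbit_id.
have ty : porbit t y \subset porbit s x by apply: stable_porbit.
have cx : #|porbit t x| = j by apply: card_porbit_cut.
have oy : #|porbit s y| = #|porbit s x|.
  by move: yx; rewrite -eq_porbit_mem => /eqP ->.
(* Seen from [y], the point [x] lies [#|porbit s x| - j] steps ahead, so the length of this piece
   follows from the same count with [x] and [y] exchanged. *)
have cy : #|porbit t y| = (#|porbit s x| - j)%N.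
  have xE : x = (s ^+ (#|porbit s x| - j))%g y.
    rewrite -permM -expgD subnKC; last by case/andP: jl => _ /ltnW.
    by rewrite permX iter_porbit.
  rewrite /t tpermC {1}xE card_porbit_cut // oy; lia.
have yt : y \notin porbit t x by apply: porbit_cut_notin.
have dE : porbit s x :\: porbit t x = porbit t y.
  apply/eqP; rewrite eq_sym eqEcard subsetD ty /=.
  rewrite cardsD (setIidPr tx) cx cy leqnn andbT.
  apply/pred0P=> z /=; apply/negP=> /andP[]; rewrite -!eq_porbit_mem => /eqP zy /eqP zx.
  by case/negP: yt; rewrite -eq_porbit_mem -zx -zy.
rewrite (cycle_weight_split f (B := porbit t x)) //; last exact: porbit_stable.
by rewrite dE !cycle_weight_porbit cx cy.
Qed.

End CycleWeight.

(** * Transport of cycles along an injection *)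

Section Transport.
Variables (T1 T2 : finType) (h : T1 -> T2) (s1 : {perm T1}) (s2 : {perm T2}).
Hypothesis h_inj : injective h.
Hypothesis h_morph : forall x, s2 (h x) = h (s1 x).

Lemma porbit_transport x : porbit s2 (h x) = h @: porbit s1 x.
Proof.
have E n : (s2 ^+ n)%g (h x) = h ((s1 ^+ n)%g x).
  by elim: n => [|n IH]; rewrite ?expg0 ?perm1 // !expgSr !permM IH.
apply/setP=> z; apply/porbitP/imsetP=> [[n ->]|[_ /porbitP[n ->] ->]].
  by exists ((s1 ^+ n)%g x); rewrite ?mem_porbit.
by exists n.
Qed.

Lemma porbits_transport (A : {set T1}) :
  [set o in porbits s2 | o \subset h @: A] =
  [set h @: o | o : {set T1} in [set o in porbits s1 | o \subset A]].
Proof.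
apply/setP=> o; rewrite inE; apply/andP/imsetP.
  case=> /imsetP[z _ ->] /subsetP zA.
  have /imsetP[x xA zE] := zA _ (porbit_id s2 z); exists (porbit s1 x).
    rewrite inE mem_porbits /=; apply/subsetP=> y xy.
    have := zA (h y); rewrite zE porbit_transport mem_imset // => /(_ xy).
    by rewrite mem_imset.
  by rewrite zE porbit_transport.
case=> o'; rewrite inE => /andP[/imsetP[x _ ->] xA] ->.
by rewrite -porbit_transport mem_porbits porbit_transport imsetS.
Qed.

Lemma cycle_weight_transport (R : comNzRingType) (f : nat -> R) (A : {set T1}) :
  cycle_weight f s2 (h @: A) = cycle_weight f s1 A.
Proof.
rewrite /cycle_weight -big_set porbits_transport big_imset /=; last first.
  by move=> o1 o2 _ _; apply: imset_inj.
by rewrite big_set; apply: eq_bigr => o _; rewrite card_imset.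
Qed.

End Transport.

(** The two products are conjugate by [s], which maps [A] onto itself; [s] is used as the transport
    map. *)
Lemma cycle_weightM (T : finType) (R : comNzRingType) (f : nat -> R)
    (s t : {perm T}) (A : {set T}) : stable s A ->
  cycle_weight f (s * t)%g A = cycle_weight f (t * s)%g A.
Proof.
move=> sA; have sI : s @: A = A.
  apply/eqP; rewrite eqEcard card_imset ?leqnn ?andbT; last exact: perm_inj.
  by apply/subsetP=> _ /imsetP[z zA ->]; apply: sA.
rewrite -{2}sI (cycle_weight_transport (s1 := (s * t)%g)) //; first exact: perm_inj.
by move=> x; rewrite !permM.
Qed.

(** * Inserting a new point into a permutation *)

Section Insertion.
Variables (T : finType) (R : comNzRingType) (f : nat -> R).
Variables (A : {set T}) (x : T) (s : {perm T}).
Hypotheses (xA : x \notin A) (sA : perm_on A s).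

Let sx : s x = x. Proof. exact: out_perm sA xA. Qed.

Let orbx : porbit s x = [set x].
Proof.
apply/setP=> z; rewrite inE; apply/porbitP/eqP=> [[i ->]|->]; last first.
  by exists 0%N; rewrite perm1.
by elim: i => [|i IH]; rewrite ?perm1 // expgSr permM IH.
Qed.

Let AU : stable s (x |: A).
Proof.
move=> z; rewrite !inE => /orP[/eqP->|zA]; first by rewrite sx eqxx.
by rewrite (perm_closed _ sA) zA orbT.
Qed.

Let orbA y : y \in A -> porbit s y \subset A.
Proof. by apply: stable_porbit; apply: perm_on_stable. Qed.

Let xorb y : y \in A -> x \notin porbit s y.
Proof. by move=> yA; apply: contra xA; apply/subsetP/orbA. Qed.

Let dropx (B : {set T}) : x \in B -> (x |: A) :\: B = A :\: B.
Proof.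
by move=> xB; apply/setP=> z; rewrite !inE; case: eqP => // ->; rewrite xB.
Qed.

Let A1 : A :\: [set x] = A.
Proof. by apply/setDidPl; rewrite disjoint_sym disjoints1. Qed.

Lemma cycle_weight_insert1 : cycle_weight f s (x |: A) = f 1%N * cycle_weight f s A.
Proof.
rewrite (cycle_weight_split f (B := [set x])) ?sub1set ?setU11 //; last first.
  by rewrite -orbx; apply: porbit_stable.
by rewrite dropx ?set11 // -{1}orbx cycle_weight_porbit orbx cards1 A1.
Qed.

Lemma porbit_insert y : y \in A ->
  porbit (s * tperm y x)%g x = x |: porbit s y.
Proof. by move=> yA; rewrite tpermC porbit_merge ?orbx // xorb. Qed.

(** This is the merging of the cycle of [y] with the fixed point [x]. *)
Lemma cycle_weight_insert y : y \in A ->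
  cycle_weight f (s * tperm y x)%g (x |: A) =
  f #|porbit s y|.+1 * cycle_weight f s (A :\: porbit s y).
Proof.
move=> yA; rewrite tpermC cycle_weight_merge ?setU11 ?inE ?yA ?orbT ?xorb //.
by rewrite orbx cards1 setDDl dropx ?inE ?eqxx // -setDDl A1.
Qed.

Let stable_insert y : y \in A -> stable (s * tperm y x)%g (x |: A).
Proof.
move=> yA; apply: stableM => //.
by apply: stable_tperm; rewrite !inE ?yA ?eqxx ?orbT.
Qed.

(** After insertion [x] lies on a cycle of length [#|porbit s y|.+1]. The points [z] are the other
    points of that cycle, one at each distance [j] from [x], and cutting at [z] yields lengths [j]
    and the rest. *)
Lemma cycle_weight_insert_cut y : y \in A ->
  \sum_(z in porbit s y) cycle_weight f (s * tperm y x * tperm z x)%g (x |: A) =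
  (\sum_(1 <= j < #|porbit s y|.+1) f j * f (#|porbit s y|.+1 - j)%N)
    * cycle_weight f s (A :\: porbit s y).
Proof.
move=> yA; set s1 := (s * tperm y x)%g; set l := #|porbit s y|.
have c1 : #|porbit s1 x| = l.+1.
  by rewrite porbit_insert // cardsU1 xorb.
(* Rewritten in this way, the sum can be enumerated by powers of [s1] starting from [x]; the power
   [0] is the excluded point. *)
transitivity (\sum_(z in porbit s1 x | z != x)
    cycle_weight f (s1 * tperm z x)%g (x |: A)).
  apply: eq_bigl => z; rewrite porbit_insert // !inE.
  by case: eqP => [->|_]; rewrite ?andbT //= (negPf (xorb yA)).
rewrite big_mkcondr sum_porbit c1 big_ltn // expg0 perm1 eqxx add0r mulr_suml.
apply: eq_big_nat => j /andP[j0 jl].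
rewrite expg_porbit_neq ?c1 ?j0 // tpermC.
rewrite cycle_weight_cut ?setU11 ?c1 ?j0 //; last exact: stable_insert.
congr (_ * _); rewrite porbit_insert // dropx ?setU11 //.
have -> : A :\: (x |: porbit s y) = A :\: porbit s y.
  apply/setP=> z; rewrite !inE; case: eqP => //= ->.
  by rewrite (negPf xA) !andbF.
apply/esym/eq_in_cycle_weight.
  by apply: stableD; [exact: perm_on_stable | exact: porbit_stable].
move=> z; rewrite inE => /andP[zO zA]; rewrite permM tpermD //.
  by apply: contra zO => /eqP ->; rewrite porbit_sym (mem_porbit s 1).
by apply: contra xA => /eqP ->; rewrite (perm_closed _ sA).
Qed.

(** Here [z] lies on a cycle untouched by the insertion, so the second transposition joins it with
    the enlarged cycle of [y]. *)
Lemma cycle_weight_insert_merge y z : y \in A -> z \in A :\: porbit s y ->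
  cycle_weight f (s * tperm y x * tperm z x)%g (x |: A) =
  f (#|porbit s y| + #|porbit s z|).+1
    * cycle_weight f s (A :\: porbit s y :\: porbit s z).
Proof.
move=> yA; rewrite inE => /andP[zO zA].
have sD : stable s (A :\: porbit s y).
  by apply: stableD; [exact: perm_on_stable | exact: porbit_stable].
have E : {in A :\: porbit s y, s =1 (s * tperm y x)%g}.
  move=> t; rewrite inE => /andP[tO tA]; rewrite permM tpermD //.
    by apply: contra tO => /eqP ->; rewrite porbit_sym (mem_porbit s 1).
  by apply: contra xA => /eqP ->; rewrite (perm_closed _ sA).
have zD : z \in A :\: porbit s y by rewrite inE zO.
have oz := eq_in_porbit sD E zD.
have xz : x \notin porbit (s * tperm y x)%g z by rewrite -oz xorb.
rewrite [tperm z x]tpermC.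
rewrite (cycle_weight_merge f (stable_insert yA)) ?setU11 ?inE ?zA ?orbT //.
rewrite -oz porbit_insert // cardsU1 xorb // add1n; congr (_ * _).
rewrite dropx ?setU11 //.
have -> : A :\: (x |: porbit s y) = A :\: porbit s y.
  apply/setP=> t; rewrite !inE; case: eqP => //= ->.
  by rewrite (negPf xA) !andbF.
apply/esym/eq_in_cycle_weight.
  by apply: stableD => //; exact: porbit_stable.
by move=> t /setDP[/E].
Qed.

End Insertion.

(** Insertion into an existing cycle changes a length but not the number of cycles. *)
Lemma cycle_weight_insert_const (T : finType) (R : comNzRingType) (c : R)
    (A : {set T}) x (s : {perm T}) y : x \notin A -> perm_on A s -> y \in A ->
  cycle_weight (fun=> c) (s * tperm y x)%g (x |: A) = cycle_weight (fun=> c) s A.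
Proof.
move=> xA sA yA; rewrite cycle_weight_insert //.
have sO := porbit_stable (s := s) (x := y).
rewrite [RHS](cycle_weight_split _ sO) ?cycle_weight_porbit //.
by apply: stable_porbit => //; apply: perm_on_stable.
Qed.

(** A permutation of [x |: A] is determined by the image [y] of [x] and by the permutation of [A]
    left after composing with [tperm y x], which makes [x] fixed. The case [y = x] gives the trivial
    transposition. *)
Lemma sum_perm_insert (T : finType) (V : nmodType) (A : {set T}) x
    (g : {perm T} -> V) : x \notin A ->
  \sum_(s | perm_on (x |: A) s) g s =
  \sum_(s | perm_on A s) \sum_(y in x |: A) g (s * tperm y x)%g.
Proof.
move=> xA; rewrite pair_big_dep /=.
rewrite (reindex_onto (fun q : {perm T} * T => (q.1 * tperm q.2 x)%g)
   (fun s => ((s * tperm (s x) x)%g, s x))) /=; last first.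
  by move=> s _; rewrite -mulgA tperm2 mulg1.
apply: eq_bigl => -[s y] /=; rewrite xpair_eqE.
apply/idP/idP=> [/andP[tU /andP[/eqP _ /eqP ty]]|/andP[sA yA]].
  have yA : y \in x |: A by rewrite -ty (perm_closed _ tU) setU11.
  rewrite yA andbT; have sx : s x = x.
    by apply: (@perm_inj _ (tperm y x)); rewrite tpermR -permM.
  apply/subsetP=> z; rewrite inE; apply: contraR => zA.
  have [-> //|zx] := eqVneq z x; first exact/eqP.
  have zU : z \notin x |: A by rewrite !inE negb_or zx.
  have zy : y != z by apply: contraNneq zU => <-.
  apply/eqP/(@perm_inj _ (tperm y x)); rewrite -permM (out_perm tU zU).
  by rewrite tpermD // eq_sym.
have sx : s x = x := out_perm sA xA.
have tx : (s * tperm y x)%g x = y by rewrite permM sx tpermR.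
rewrite tx -mulgA tperm2 mulg1 !eqxx /= andbT.
apply/subsetP=> z; rewrite inE; apply: contraR => zU.
have zA : z \notin A by apply: contra zU; apply: setU1r.
rewrite permM (out_perm sA zA) tpermD //.
  by apply: contraNneq zU => <-.
by apply: contraNneq zU => <-; apply: setU11.
Qed.

(** * Derivations and the operators *)

Lemma pderivD x (f g : Qup) : pderiv x (f + g) = pderiv x f + pderiv x g.
Proof. by apply/malgP=> t; rewrite mcoeff_pderiv !mcoeffD !mcoeff_pderiv mulrnDl. Qed.

Lemma pderivZ x (c : rat) (f : Qup) : pderiv x (c *: f) = c *: pderiv x f.
Proof.
apply/malgP=> t; rewrite !Qup_scaleE mcoeff_pderiv !mcoeffZ mcoeff_pderiv.
by rewrite mulrnAr.
Qed.

Lemma ucmMI y : injective (mmul^~ (ucm y) : {cmonom var} -> {cmonom var}).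
Proof.
move=> s t E; apply/eqP/cmP=> z; apply/eqP.
by rewrite -(eqn_add2r (ucm y z)) -!cmM E.
Qed.

Lemma divcmK y (t : {cmonom var}) : (0 < t y)%N -> mmul (divcm t (ucm y)) (ucm y) = t.
Proof.
move=> ty; apply/eqP/cmP=> z; rewrite cmM divcmE cmU.
by case: eqP => [<-|_]; rewrite ?subnK // subn0 addn0.
Qed.

Lemma mcoeffXM y (f : Qup) (t : {cmonom var}) :
  (X y * f)@_(mmul t (ucm y)) = f@_t.
Proof.
rewrite Qup_mulE X.unlock malgM_def fgmulUg raddf_sum /=.
rewrite [in RHS](monalgE f) raddf_sum /=; apply: eq_bigr => k _.
rewrite !mcoeffU mul1r; congr (_ *+ nat_of_bool _).
have -> : mmul (ucm y) k = mmul k (ucm y).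
  by apply/eqP/cmP=> z; rewrite !cmM addnC.
by rewrite (inj_eq (@ucmMI y)).
Qed.

Lemma mcoeffXM0 y (f : Qup) (t : {cmonom var}) : t y = 0%N -> (X y * f)@_t = 0.
Proof.
move=> ty; rewrite Qup_mulE X.unlock malgM_def fgmulUg raddf_sum big1 //= => k _.
by rewrite mcoeffU; case: eqP => // tE; move: ty; rewrite -tE cmM cmU eqxx.
Qed.

(** The Leibniz rule for one variable factor, compared coefficientwise; derivatives of products of
    the [p k] follow by iteration. *)
Lemma pderivXM x y (f : Qup) :
  pderiv x (X y * f) = (x == y)%:R * f + X y * pderiv x f.
Proof.
apply/malgP=> t; rewrite mcoeff_pderiv mcoeffD.
have [<-|xy] := eqVneq x y.
  rewrite mcoeffXM mul1r mulrSr addrC; congr (_ + _).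
  have [tx|tx] := posnP (t x); first by rewrite tx mcoeffXM0 // mulr0n.
  rewrite -{3}(divcmK tx) mcoeffXM mcoeff_pderiv divcmK //.
  by rewrite divcmE cmU eqxx subn1 prednK.
rewrite mul0r mcoeff0 add0r.
have tE : (mmul t (ucm x)) y = t y by rewrite cmM cmU (negPf xy) addn0.
have [ty|ty] := posnP (t y); first by rewrite !mcoeffXM0 ?tE // mul0rn.
rewrite -{1 3}(divcmK ty) mcoeffXM mcoeff_pderiv.
have -> : mmul (mmul (divcm t (ucm y)) (ucm y)) (ucm x) =
    mmul (mmul (divcm t (ucm y)) (ucm x)) (ucm y).
  by apply/eqP/cmP=> z; rewrite !cmM addnAC.
by rewrite mcoeffXM divcmE cmU eq_sym (negPf xy) subn0.
Qed.

(** Independence of all [p] variables, phrased as a commutation so that closure under products is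
    immediate. *)
Definition dp_constant (a : Qup) := forall i f, dp i (a * f) = a * dp i f.

Lemma dp_constant_u : dp_constant u.
Proof. by move=> i f; rewrite /dp pderivXM mul0r add0r. Qed.

Lemma dp_constant_v : dp_constant v.
Proof. by move=> i f; rewrite /dp pderivXM mul0r add0r. Qed.

Lemma dp_constantM a b : dp_constant a -> dp_constant b -> dp_constant (a * b).
Proof. by move=> ca cb i f; rewrite -mulrA ca cb mulrA. Qed.

Lemma dp_constantX a n : dp_constant a -> dp_constant (a ^+ n).
Proof.
move=> ca; elim: n => [|n IH]; last by rewrite exprS; apply: dp_constantM.
by move=> i f; rewrite !mul1r.
Qed.

Lemma dp_constantZ (c : rat) : dp_constant (c *: 1).
Proof. by move=> i f; rewrite -!scalerAl !mul1r /dp pderivZ. Qed.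

Lemma dpD i (f g : Qup) : dp i (f + g) = dp i f + dp i g.
Proof. exact: pderivD. Qed.

Lemma dp0 i : dp i 0 = 0.
Proof. by have := pderivZ (inr i.-1) 0 0; rewrite !scale0r. Qed.

Lemma dp_sum i (I : Type) (r : seq I) (P : pred I) (F : I -> Qup) :
  dp i (\sum_(j <- r | P j) F j) = \sum_(j <- r | P j) dp i (F j).
Proof. by apply: (big_morph (dp i)); [exact: dpD | exact: dp0]. Qed.

Lemma dp_pM i k f : (0 < i)%N -> (0 < k)%N ->
  dp i (p k * f) = (i == k)%:R * f + p k * dp i f.
Proof. by case: i k => [//|i] [//|k] _ _; rewrite /dp /p pderivXM. Qed.

Lemma evolE n f : (opbound f <= n)%N -> evol f =
  (u + v) * \sum_(2 <= i < n) Lambda1_term i f + \sum_(2 <= i < n) M1_term i f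
    + u * v * p 1 * f.
Proof. by move=> fn; rewrite /evol (Lambda1E fn) (M1E fn). Qed.

Lemma evolM a f : dp_constant a -> evol (a * f) = a * evol f.
Proof.
(* The truncation of the operators depends on the argument; a common bound makes the sums comparable
   term by term. *)
move=> ca; set n := maxn (opbound f) (opbound (a * f)).
rewrite !(evolE (n := n)) ?leq_maxl ?leq_maxr //.
have Lm i : Lambda1_term i (a * f) = a * Lambda1_term i f.
  by rewrite /Lambda1_term ca mulrCA.
have Mm i : M1_term i (a * f) = a * M1_term i f.
  rewrite /M1_term mulr_sumr; apply: eq_bigr => j _.
  by rewrite !ca mulrDr !(mulrCA _ a).
under eq_bigr do rewrite Lm; under [in X in _ + X + _]eq_bigr do rewrite Mm.
by rewrite -!mulr_sumr !mulrDr !(mulrCA _ a).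
Qed.

Lemma evolD (f g : Qup) : evol (f + g) = evol f + evol g.
Proof.
set n := maxn (opbound (f + g)) (maxn (opbound f) (opbound g)).
rewrite !(evolE (n := n)) /n ?leq_max ?leqnn ?orbT //.
have Lm i : Lambda1_term i (f + g) = Lambda1_term i f + Lambda1_term i g.
  by rewrite /Lambda1_term dpD mulrDr.
have Mm i : M1_term i (f + g) = M1_term i f + M1_term i g.
  rewrite /M1_term -big_split; apply: eq_bigr => j _ /=.
  by rewrite !dpD !mulrDr addrACA.
under eq_bigr do rewrite Lm; under [in X in _ + X + _]eq_bigr do rewrite Mm.
rewrite !big_split /= !(mulrDr (u + v)) (mulrDr (u * v * p 1)).
by rewrite [X in X + _]addrACA [LHS]addrACA.
Qed.

Lemma evolZ (c : rat) f : evol (c *: f) = c *: evol f.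
Proof.
by rewrite -(mul1r f) scalerAl evolM -?scalerAl ?mul1r //; apply: dp_constantZ.
Qed.

Lemma evol0 : evol 0 = 0.
Proof. by have := evolZ 0 0; rewrite !scale0r. Qed.

Lemma evol_sum (I : Type) (r : seq I) (P : pred I) (F : I -> Qup) :
  evol (\sum_(j <- r | P j) F j) = \sum_(j <- r | P j) evol (F j).
Proof. by apply: (big_morph evol); [exact: evolD | exact: evol0]. Qed.

Lemma dp1 i : dp i 1 = 0.
Proof.
apply/malgP=> t; rewrite mcoeff_pderiv mcoeff0; set m := mmul _ _.
have -> : (1 : Qup)@_m = (m == mone)%:R by apply: mcoeff1.
suff /negPf -> : m != mone by rewrite mul0rn.
by apply/negP=> /eqP /(congr1 (fun z : {cmonom var} => z (inr i.-1)));
  rewrite cmM cmU eqxx cm1 addn1.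
Qed.

Lemma dp_prod i (I : finType) (g : I -> nat) (S : {set I}) :
    (0 < i)%N -> (forall o, o \in S -> (0 < g o)%N) ->
  dp i (\prod_(o in S) p (g o)) =
  \sum_(o in S) (i == g o)%:R * \prod_(o' in S :\ o) p (g o').
Proof.
move=> i0; have [n] := ubnP #|S|; elim: n S => // n IH S Sn gS.
have [->|[o oS]] := set_0Vmem S; first by rewrite !big_set0 dp1.
rewrite (big_setD1 o) //= dp_pM ?gS // [RHS](big_setD1 o) //= IH; last first.
- by move=> o' /setD1P[_ /gS].
- by move: Sn; rewrite (cardsD1 o) oS ltnS.
congr (_ + _); rewrite mulr_sumr; apply: eq_bigr => o' /setD1P[o'o o'S].
rewrite mulrCA; congr (_ * _); rewrite [RHS](big_setD1 o) ?inE ?oS 1?eq_sym ?o'o //=.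
by rewrite setDDl setUC -setDDl.
Qed.

(** * The evolution operator on cycle weights *)

Section CycleWeightEvolution.
Variable T : finType.
Implicit Types (A : {set T}) (s : {perm T}).

Lemma cycle_weight_setE (f : nat -> Qup) s A :
  cycle_weight f s A = \prod_(o in [set o in porbits s | o \subset A]) f #|o|.
Proof. by apply: eq_bigl => o; rewrite inE. Qed.

(** Differentiating the monomial removes one cycle of length [i], and removing a factor amounts to
    shrinking [A]. *)
Lemma dp_cycle_weight i s A : (0 < i)%N ->
  dp i (cycle_weight p s A) =
  \sum_(o in porbits s | o \subset A) (i == #|o|)%:R * cycle_weight p s (A :\: o).
Proof.
move=> i0; rewrite cycle_weight_setE dp_prod //; last first.
  by move=> o; rewrite inE => /andP[/imsetP[x _ ->] _]; rewrite lt0n card_porbit_neq0.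
rewrite (eq_bigl (fun o => (o \in porbits s) && (o \subset A))); last first.
  by move=> o; rewrite inE.
apply: eq_bigr => o /andP[os oA]; congr (_ * _); rewrite cycle_weight_setE.
apply: eq_bigl => o'; rewrite !inE subsetD.
have [/imsetP[y _ ->]|] := boolP (o' \in porbits s); last by rewrite !andbF.
case/imsetP: os => x _ -> /=; rewrite andbC; congr (_ && _).
apply/idP/pred0P=> [xy z /=|dis].
  apply/negP=> /andP[]; rewrite -!eq_porbit_mem => /eqP zy /eqP zx.
  by case/negP: xy; rewrite -zx -zy.
by apply/negP=> /eqP E; have := dis y; rewrite /= -E porbit_id.
Qed.

(** It turns the numerical coefficients of the operators, which are cycle lengths, into choices of a
    point on a cycle. *)
Lemma sum_porbits (V : nmodType) (g : {set T} -> V) s A : stable s A ->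
  \sum_(y in A) g (porbit s y) =
  \sum_(o in porbits s | o \subset A) g o *+ #|o|.
Proof.
move=> sA; rewrite (partition_big (porbit s)
  (fun o => (o \in porbits s) && (o \subset A))) /=; last first.
  by move=> y yA; rewrite mem_porbits stable_porbit.
apply: eq_bigr => _ /andP[/imsetP[x _ ->] xA].
rewrite (eq_bigr (fun=> g (porbit s x))); last by move=> y /andP[_ /eqP->].
rewrite sumr_const; congr (_ *+ _); apply: eq_card => y.
rewrite unfold_in /= eq_porbit_mem andb_idl // => yx.
by rewrite (subsetP xA).
Qed.

(** The derivative removes a cycle of length [i.-1], and the factor [i.-1] chooses a point [y] on
    it. A general [g] serves [Lambda1] with [g = p], the first part of [M1] with a sum of products,
    and the second part after a shift. *)
Lemma sum_dp_cycle_weight (g : nat -> Qup) n s A : stable s A -> (#|A|.+1 < n)%N ->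
  \sum_(2 <= i < n) (i.-1)%:R * g i * dp i.-1 (cycle_weight p s A) =
  \sum_(y in A) g #|porbit s y|.+1 * cycle_weight p s (A :\: porbit s y).
Proof.
move=> sA An.
rewrite (sum_porbits (fun o => g #|o|.+1 * cycle_weight p s (A :\: o)) sA).
transitivity (\sum_(2 <= i < n) \sum_(o in porbits s | o \subset A)
   (i == #|o|.+1)%:R * ((i.-1)%:R * g i * cycle_weight p s (A :\: o))).
  apply: eq_big_nat => i /andP[i2 _]; rewrite dp_cycle_weight; last by lia.
  rewrite mulr_sumr; apply: eq_bigr => o _; rewrite mulrCA; congr (_%:R * _).
  by case: i i2.
rewrite exchange_big /=; apply: eq_bigr => o /andP[/imsetP[x _ ->] xA].
have ox : (0 < #|porbit s x|)%N by rewrite lt0n card_porbit_neq0.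
have oA := subset_leq_card xA.
(* Only [i = #|porbit s x|.+1] survives; it is at least [2] as the cycle is nonempty, and below [n]
   by the bound on [#|A|]. *)
rewrite (big_cat_nat _ (n := #|porbit s x|.+1)) /=; [|lia|lia].
rewrite big_nat big1 ?add0r => [|i /andP[_ il]]; last by rewrite ltn_eqF ?mul0r.
rewrite big_ltn; last by lia.
rewrite eqxx mul1r big_nat big1 ?addr0 => [|i /andP[il _]]; last first.
  by rewrite gtn_eqF ?mul0r.
by rewrite -mulrA mulr_natl.
Qed.

(** The condition forces [j = i - k]; shifting [i] by [k.-1] turns this into [j = i.-1], the shape
    of a first-order sum. *)
Lemma sum_nat_sub_eq (V : nmodType) (H : nat -> nat -> V) k n : (0 < k)%N ->
  \sum_(2 <= i < n) \sum_(1 <= j < i) H i j *+ (i - j == k)%N =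
  \sum_(2 <= i < n - k.-1) H (i + k.-1)%N i.-1.
Proof.
move=> k0; have inner i : \sum_(1 <= j < i) H i j *+ (i - j == k)%N =
    if (k < i)%N then H i (i - k)%N else 0.
  case: ltnP => ki; last first.
    rewrite big_nat big1 // => j /andP[j1 ji].
    by case: eqP => // E; exfalso; lia.
  rewrite (bigD1_seq (i - k)%N) ?iota_uniq ?mem_index_iota //=; last by lia.
  have -> : (i - (i - k) == k)%N by lia.
  rewrite mulr1n big_nat_cond big1 ?addr0 // => j /andP[/andP[j1 ji] jk].
  by case: eqP => // E; exfalso; lia.
under eq_bigr do rewrite inner.
have [nk|nk] := leqP n k.+1.
  rewrite [RHS]big_geq; last by lia.
  by rewrite big_nat big1 // => i /andP[_ i_n]; case: ltnP => // ki; exfalso; lia.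
rewrite (big_cat_nat _ (n := k.+1)) /=; [|lia|lia].
rewrite big_nat big1 ?add0r => [|i /andP[_ ik]]; last by rewrite ltnNge -ltnS ik.
have -> : k.+1 = (2 + k.-1)%N by lia.
rewrite big_addn; apply: eq_big_nat => i /andP[i2 _].
rewrite ifT; last by lia.
by congr H; lia.
Qed.

Lemma dp_natM i k (f : Qup) : dp i (k%:R * f) = k%:R * dp i f.
Proof. by rewrite -scaler_nat; apply: dp_constantZ. Qed.

(** The two derivatives remove two distinct cycles, of lengths [i - j] and then [j]; the coefficient
    chooses a point [y] on the first and [z] on the second. *)
Lemma sum_dp_dp_cycle_weight n s A : stable s A -> (#|A|.+1 < n)%N ->
  \sum_(2 <= i < n) \sum_(1 <= j < i)
     (j * (i - j))%:R * p i.+1 * dp j (dp (i - j) (cycle_weight p s A)) =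
  \sum_(y in A) \sum_(z in A :\: porbit s y)
     p (#|porbit s y| + #|porbit s z|).+1
       * cycle_weight p s (A :\: porbit s y :\: porbit s z).
Proof.
move=> sA An.
pose G o : Qup := \sum_(z in A :\: o) p (#|o| + #|porbit s z|).+1
       * cycle_weight p s (A :\: o :\: porbit s z).
rewrite (sum_porbits G sA).
transitivity (\sum_(o in porbits s | o \subset A) \sum_(2 <= i < n) \sum_(1 <= j < i)
   (j%:R * (#|o|%:R * p i.+1) * dp j (cycle_weight p s (A :\: o)))
     *+ (i - j == #|o|)%N).
  rewrite exchange_big /=; apply: eq_big_nat => i _.
  rewrite exchange_big /=; apply: eq_big_nat => j /andP[j1 ji].
  rewrite dp_cycle_weight ?subn_gt0 // dp_sum mulr_sumr; apply: eq_bigr => o _.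
  rewrite dp_natM; case: eqP => [->|_]; last by rewrite mul0r mulr0.
  by rewrite mul1r mulr1n natrM !mulrA.
apply: eq_bigr => o /andP[/imsetP[x _ ->] xA].
have ox : (0 < #|porbit s x|)%N by rewrite lt0n card_porbit_neq0.
have oA := subset_leq_card xA.
(* With the cycle o removed by dp (i - j) fixed, i - j = #|o| and only the sum
   over j remains: a first-order sum for the cycles in A :\: o. *)
rewrite sum_nat_sub_eq //.
have cD : #|A :\: porbit s x| = (#|A| - #|porbit s x|)%N.
  by rewrite cardsD (setIidPr xA).
have sD : stable s (A :\: porbit s x) by apply: stableD => //; apply: porbit_stable.
rewrite (sum_dp_cycle_weight
  (fun i => #|porbit s x|%:R * p (i + #|porbit s x|.-1).+1)) //.
  rewrite /G -[RHS]mulr_natl mulr_sumr; apply: eq_bigr => z _.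
  rewrite -mulrA; congr (_ * (p _ * _)); lia.
by rewrite cD; lia.
Qed.

(** The three summands match multiplication by [u * v * p 1], [Lambda1] and [M1] respectively. *)
Lemma evol_cycle_weight s A x : x \notin A -> perm_on A s ->
  evol (cycle_weight p s A) =
  u * v * cycle_weight p s (x |: A)
  + (u + v) * (\sum_(y in A) cycle_weight p (s * tperm y x)%g (x |: A))
  + \sum_(y in A) \sum_(z in A)
      cycle_weight p (s * tperm y x * tperm z x)%g (x |: A).
Proof.
move=> xA sA; have ssA := perm_on_stable sA.
set n := maxn #|A|.+2 (opbound (cycle_weight p s A)).
have An : (#|A|.+1 < n)%N by rewrite leq_max leqnn.
rewrite (evolE (n := n)) ?leq_maxr // cycle_weight_insert1 //.
rewrite -!mulrA addrC -!addrA; congr (_ + _).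
rewrite (sum_dp_cycle_weight p ssA An); congr (_ + _).
  by congr (_ * _); apply: eq_bigr => y yA; rewrite cycle_weight_insert.
rewrite /M1_term; under eq_bigr do rewrite big_split /=.
rewrite big_split /= sum_dp_dp_cycle_weight //.
transitivity (\sum_(2 <= i < n) (i.-1)%:R * (\sum_(1 <= j < i) p j * p (i - j)) *
     dp i.-1 (cycle_weight p s A) + \sum_(y in A) \sum_(z in A :\: porbit s y)
     p (#|porbit s y| + #|porbit s z|).+1
       * cycle_weight p s (A :\: porbit s y :\: porbit s z)).
  congr (_ + _); apply: eq_bigr => i _.
  by rewrite mulr_sumr mulr_suml; apply: eq_bigr => j _; rewrite !mulrA.
rewrite (sum_dp_cycle_weight (fun i => \sum_(1 <= j < i) p j * p (i - j))) //.
rewrite -big_split /=; apply: eq_bigr => y yA.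
rewrite -(cycle_weight_insert_cut _ xA sA yA).
(* The second transposition cuts when [z] is on the cycle of [y], giving the first-order part of
   [M1], and joins otherwise, giving the second-order part. *)
rewrite [RHS](bigID (mem (porbit s y))) /=; congr (_ + _).
  apply: eq_bigl => z; rewrite andb_idl // => zy.
  exact: (subsetP (stable_porbit ssA yA)).
apply: eq_big => [z|z zD]; first by rewrite inE andbC.
by rewrite cycle_weight_insert_merge.
Qed.

End CycleWeightEvolution.

(** * Sums over pairs of permutations *)

Section PairSum.
Variable T : finType.
Implicit Types (A B : {set T}) (w b s t : {perm T}) (q : {perm T} * {perm T}).

Definition pair_weight A q : Qup :=
  cycle_weight (fun=> u) q.1 A * cycle_weight (fun=> v) q.2 A
    * cycle_weight p (q.1 * q.2)%g A.

Definition pair_on A q := perm_on A q.1 && perm_on A q.2.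

(** This is $W_d$ for $d = |A|$, taken over permutations of [T] supported in [A]. *)
Definition pair_sum A : Qup := \sum_(q | pair_on A q) pair_weight A q.

Lemma dp_constant_cycle_weight c s A : dp_constant c ->
  dp_constant (cycle_weight (fun=> c) s A).
Proof.
move=> cc; apply: (big_ind dp_constant) => //.
  exact: (dp_constantX 0 cc).
exact: dp_constantM.
Qed.

Lemma sum_perm_insertV (V : nmodType) A x (g : {perm T} -> V) : x \notin A ->
  \sum_(s | perm_on (x |: A) s) g s =
  \sum_(s | perm_on A s) \sum_(y in x |: A) g (tperm y x * s)%g.
Proof.
have onV B s : perm_on B s^-1%g = perm_on B s.
  by apply/idP/idP => /perm_onV //; rewrite invgK.
move=> xA; rewrite (reindex_inj invg_inj) /=.
rewrite (eq_bigl _ _ (onV (x |: A))) sum_perm_insert //.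
rewrite (reindex_inj invg_inj) /= (eq_bigl _ _ (onV A)).
by apply: eq_bigr => s _; apply: eq_bigr => y _; rewrite invMg invgK tpermV.
Qed.

Lemma cycle_weight_insert_all c A x s y : x \notin A -> perm_on A s -> y \in x |: A ->
  cycle_weight (fun=> c : Qup) (s * tperm y x)%g (x |: A) =
  (if y == x then c else 1) * cycle_weight (fun=> c) s A.
Proof.
move=> xA sA /setU1P[->|yA].
  by rewrite eqxx tperm1 mulg1 cycle_weight_insert1.
rewrite cycle_weight_insert_const // ifF ?mul1r //.
by apply: contraNF xA => /eqP <-.
Qed.

Lemma pair_sumE A : pair_sum A =
  \sum_(w | perm_on A w) \sum_(b | perm_on A b) pair_weight A (w, b).
Proof. by rewrite pair_big; apply: eq_big => -[]. Qed.

(** Inserting on the right of [w] and on the left of [b] puts the two transpositions side by side in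
    the product, so that a cyclic rotation reduces it to two successive insertions into [b * w]. *)
Lemma pair_sum_evol A x : x \notin A -> pair_sum (x |: A) = evol (pair_sum A).
Proof.
move=> xA; rewrite !pair_sumE evol_sum.
rewrite sum_perm_insert //; apply: eq_bigr => w wA; rewrite evol_sum.
under eq_bigr do rewrite sum_perm_insertV //.
rewrite exchange_big /=; apply: eq_bigr => b bA.
have bw : perm_on A (b * w)%g by apply: perm_onM.
have sU s : perm_on A s -> stable s (x |: A).
  move=> sA z; rewrite !inE => /orP[/eqP->|/(perm_on_stable sA)->].
    by rewrite (out_perm sA xA) eqxx.
  by rewrite orbT.
have wU := sU _ wA; have bU := sU _ bA.
set cw := cycle_weight (fun=> u) w A; set cb := cycle_weight (fun=> v) b A.
have ccw : dp_constant cw by apply/dp_constant_cycle_weight/dp_constant_u.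
have ccb : dp_constant cb by apply/dp_constant_cycle_weight/dp_constant_v.
rewrite {2}/pair_weight /= evolM; last exact: dp_constantM.
rewrite (cycle_weightM _ _ (perm_on_stable wA)) (evol_cycle_weight xA bw).
pose h y z := cycle_weight p (b * w * tperm y x * tperm z x)%g (x |: A).
transitivity (\sum_(y in x |: A) \sum_(z in x |: A)
  cw * cb * ((if y == x then u else 1) * (if z == x then v else 1) * h y z)).
  apply: eq_bigr => y yU; apply: eq_bigr => z zU; rewrite /pair_weight /=.
  have xU := setU11 x A.
  rewrite cycle_weight_insert_all // -/cw.
  rewrite (cycle_weightM _ b (stable_tperm zU xU)) cycle_weight_insert_all // -/cb.
  have -> : cycle_weight p (w * tperm y x * (tperm z x * b))%g (x |: A) = h y z.
    rewrite mulgA -cycle_weightM ?mulgA //.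
  by rewrite mulrACA [RHS]mulrCA -[LHS]mulrA.
under eq_bigr do rewrite -mulr_sumr.
rewrite -mulr_sumr; congr (_ * _).
have nx y : y \in A -> (y == x) = false.
  by move=> yA; apply: contraNF xA => /eqP <-.
(* The sum splits according to whether [y = x] and whether [z = x]: both give [u * v], exactly one
   gives [u] or [v], none gives the double sum. *)
rewrite big_setU1 //= eqxx big_setU1 //= eqxx.
have -> : h x x = cycle_weight p (b * w)%g (x |: A).
  by rewrite /h tperm1 !mulg1.
rewrite -!addrA; congr (_ + _).
rewrite mulrDl -addrA; congr (_ + _).
  rewrite mulr_sumr; apply: eq_bigr => z zA.
  by rewrite nx // mulr1 /h tperm1 mulg1.
rewrite mulr_sumr -big_split /=; apply: eq_bigr => y yA.
rewrite nx // big_setU1 //= eqxx mul1r {1}/h tperm1 mulg1; congr (_ + _).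
by apply: eq_bigr => z zA; rewrite nx // !mul1r.
Qed.

End PairSum.

(** * Connected components of a pair of permutations *)

Section Component.
Variable T : finType.
Implicit Types (A B : {set T}) (s t : {perm T}) (q : {perm T} * {perm T}).

Definition component q x : {set T} := orbit 'P <<[set q.1; q.2]>>%g x.

Definition pair_stable A q := stable q.1 A /\ stable q.2 A.

Definition pair_conn A q : bool :=
  [transitive <<[set q.1; q.2]>>%g, on A | 'P].

Lemma component_id q x : x \in component q x.
Proof. exact: orbit_refl. Qed.

Lemma stable_astabs s A : stable s A -> s \in ('N(A | 'P))%g.
Proof.
move=> sA; apply/astabsP=> z; apply/idP/idP => [|zA]; last exact: sA.
by move=> /(stableV sA); rewrite /= apermE permK.
Qed.

Lemma component_sub q A x : pair_stable A q -> x \in A -> component q x \subset A.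
Proof.
case=> sA tA xA; rewrite /component acts_sub_orbit //.
rewrite gen_subG; apply/subsetP=> s /set2P[]->; exact: stable_astabs.
Qed.

Lemma component_stable q x : pair_stable (component q x) q.
Proof.
have st s : s \in [set q.1; q.2] -> stable s (component q x).
  move=> sq z zx; apply: orbit_trans zx.
  exact/(mem_orbit 'P)/mem_gen.
by split; apply: st; rewrite !inE eqxx ?orbT.
Qed.

Lemma eq_in_component q q' B x : pair_stable B q -> {in B, q.1 =1 q'.1} ->
  {in B, q.2 =1 q'.2} -> x \in B -> component q x = component q' x.
Proof.
have half (r r' : {perm T} * {perm T}) : pair_stable B r -> {in B, r.1 =1 r'.1} ->
    {in B, r.2 =1 r'.2} -> x \in B -> component r' x \subset component r x.
  move=> rB e1 e2 xB; apply: component_sub; last exact: component_id.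
  have [s1 s2] := component_stable r x.
  have /subsetP sub := component_sub rB xB.
  by split=> z zx; rewrite -(e1, e2) ?sub //; [apply: s1 | apply: s2].
move=> qB e1 e2 xB; apply/eqP; rewrite eqEsubset (half _ _ qB) // andbT.
apply: half => // [|z zB|z zB]; [|by rewrite e1|by rewrite e2].
by case: qB => s1 s2; split=> z zB; rewrite -(e1, e2) //; [apply: s1 | apply: s2].
Qed.

Lemma pair_conn_component A q x : x \in A -> pair_conn A q = (component q x == A).
Proof.
move=> xA; apply/idP/eqP=> [qA|qA]; first exact: (atransP qA).
by apply/imsetP; exists x.
Qed.

Definition conn_sum A : Qup :=
  \sum_(q | pair_on A q && pair_conn A q) pair_weight A q.

Lemma restr_perm_eq s t B : perm_on B t -> {in B, s =1 t} -> restr_perm B s = t.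
Proof.
move=> tB st; have sB : stable s B by move=> z zB; rewrite st // (perm_closed _ tB).
apply/permP=> z; have [zB|zB] := boolP (z \in B).
  by rewrite restr_permE ?stable_astabs // st.
by rewrite !(out_perm _ zB) ?restr_perm_on.
Qed.

Lemma restr_perm_glue s A B : perm_on A s -> stable s B -> B \subset A ->
  (restr_perm B s * restr_perm (A :\: B) s)%g = s.
Proof.
move=> sA sB BA; have sD := stableD (perm_on_stable sA) sB.
apply/permP=> z; rewrite permM.
have [zB|zB] := boolP (z \in B).
  have -> : restr_perm B s z = s z by rewrite restr_permE ?stable_astabs.
  by rewrite (out_perm (restr_perm_on _ _)) // inE (sB _ zB).
rewrite (out_perm (restr_perm_on B _) zB).
have [zA|zA] := boolP (z \in A).
  by rewrite restr_permE ?stable_astabs // inE zB.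
by rewrite (out_perm sA zA) (out_perm (restr_perm_on _ _)) // inE zB.
Qed.

Lemma glue_on s t A B : perm_on B s -> perm_on (A :\: B) t -> B \subset A ->
  [/\ perm_on A (s * t)%g, {in B, (s * t)%g =1 s} & {in A :\: B, (s * t)%g =1 t}].
Proof.
move=> sB tD BA; split=> [|z zB|z /setDP[_ zB]].
- apply: perm_onM; first exact: subset_trans BA.
  by apply: subset_trans tD _; apply: subsetDl.
- by rewrite permM (out_perm tD) // inE (perm_closed _ sB) zB.
by rewrite permM (out_perm sB).
Qed.

Definition pair_restr B q := (restr_perm B q.1, restr_perm B q.2).

Definition pair_glue (r : ({perm T} * {perm T}) * ({perm T} * {perm T})) :=
  ((r.1.1 * r.2.1)%g, (r.1.2 * r.2.2)%g).

Lemma pair_weight_split A B q q1 q2 : B \subset A -> pair_on B q1 ->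
    pair_on (A :\: B) q2 -> q = pair_glue (q1, q2) ->
  pair_weight A q = pair_weight B q1 * pair_weight (A :\: B) q2.
Proof.
move=> BA /andP[w1 b1] /andP[w2 b2] ->.
have [wA wB wD] := glue_on w1 w2 BA; have [bA bB bD] := glue_on b1 b2 BA.
have sw : stable (q1.1 * q2.1)%g B by move=> z zB; rewrite wB // (perm_closed _ w1).
have sb : stable (q1.2 * q2.2)%g B by move=> z zB; rewrite bB // (perm_closed _ b1).
have swD := stableD (perm_on_stable wA) sw.
have sbD := stableD (perm_on_stable bA) sb.
rewrite /pair_weight !(cycle_weight_split _ _ BA) //; last exact: stableM.
rewrite (eq_in_cycle_weight _ sw wB) (eq_in_cycle_weight _ sb bB).
rewrite (eq_in_cycle_weight _ swD wD) (eq_in_cycle_weight _ sbD bD) /=.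
rewrite (eq_in_cycle_weight (t := (q1.1 * q1.2)%g) _ (stableM sw sb)); last first.
  by move=> z zB; rewrite permM wB // bB ?(perm_closed _ w1) // permM.
rewrite (eq_in_cycle_weight (t := (q2.1 * q2.2)%g) _ (stableM swD sbD)); last first.
  by move=> z zB; rewrite permM wD // bD ?(perm_closed _ w2) // permM.
by rewrite [X in X * _]mulrACA [LHS]mulrACA.
Qed.

(** [B] is the component of [x]. The pair restricts to a transitive pair on [B] and to an arbitrary
    pair on the complement, and weights are multiplicative. *)
Lemma pair_sum_decomp A x : x \in A -> pair_sum A =
  \sum_(B : {set T} | (B \subset A) && (x \in B)) conn_sum B * pair_sum (A :\: B).
Proof.
move=> xA; rewrite {1}/pair_sum (partition_big (component^~ x)
  (fun B : {set T} => (B \subset A) && (x \in B))) /=; last first.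
  move=> q /andP[wA bA]; rewrite component_id andbT.
  by apply: component_sub => //; split; apply: perm_on_stable.
apply: eq_bigr => B /andP[BA xB].
rewrite /conn_sum /pair_sum big_distrlr /= pair_big_dep /=.
(* Restriction to [B] and its complement is inverse to gluing, because [B] is stable under both
   permutations. *)
rewrite (reindex_onto pair_glue (fun q => (pair_restr B q, pair_restr (A :\: B) q))) /=;
    last first.
  move=> [w b] /andP[/andP[/= wA bA] /eqP qB].
  have [sw sb] := component_stable (w, b) x; rewrite qB in sw sb.
  by rewrite /pair_glue /= !restr_perm_glue.
have on_restr C q : pair_on C (pair_restr C q) by rewrite /pair_on !restr_perm_on.
have comp_glue q1 q2 : pair_on B q1 -> pair_on (A :\: B) q2 ->
    component (pair_glue (q1, q2)) x = component q1 x.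
  move=> /andP[w1 b1] /andP[w2 b2].
  have [_ wB _] := glue_on w1 w2 BA; have [_ bB _] := glue_on b1 b2 BA.
  apply/esym/(eq_in_component (B := B)) => //; first by split; apply: perm_on_stable.
    by move=> z zB; rewrite /= wB.
  by move=> z zB; rewrite /= bB.
apply: eq_big => [[q1 q2] /=|[q1 q2] /= /andP[_ /eqP[E1 E2]]]; last first.
  by apply: pair_weight_split => //; [rewrite -E1 | rewrite -E2]; apply: on_restr.
apply/idP/idP=> [/andP[/andP[_ qB] /eqP[E1 E2]]|/andP[/andP[on1 cq] on2]].
  have on1 : pair_on B q1 by rewrite -E1 on_restr.
  have on2 : pair_on (A :\: B) q2 by rewrite -E2 on_restr.
  by rewrite on1 on2 (pair_conn_component _ xB) -(comp_glue _ _ on1 on2) qB.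
rewrite (comp_glue _ _ on1 on2) -(pair_conn_component _ xB) cq andbT.
case/andP: on1 => w1 b1; case/andP: on2 => w2 b2.
have [wA wB wD] := glue_on w1 w2 BA; have [bA bB bD] := glue_on b1 b2 BA.
rewrite /pair_on wA bA /= /pair_restr /= !xpair_eqE.
by rewrite !(restr_perm_eq _ wB) // !(restr_perm_eq _ bB) //
  !(restr_perm_eq _ wD) // !(restr_perm_eq _ bD) // -!surjective_pairing !eqxx.
Qed.

End Component.

(** Images and preimages of components under an equivariant map are stable, and a component is the
    least stable set through its point. *)
Lemma component_transport (T1 T2 : finType) (h : T1 -> T2)
    (q1 : {perm T1} * {perm T1}) (q2 : {perm T2} * {perm T2}) x :
    (forall i, q2.1 (h i) = h (q1.1 i)) -> (forall i, q2.2 (h i) = h (q1.2 i)) ->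
  component q2 (h x) = h @: component q1 x.
Proof.
move=> e1 e2; apply/eqP; rewrite eqEsubset; apply/andP; split.
  apply: component_sub; last by rewrite imset_f ?component_id.
  have [s1 s2] := component_stable q1 x.
  by split=> _ /imsetP[i ic ->]; rewrite (e1, e2) imset_f //; [apply: s1|apply: s2].
apply/subsetP=> _ /imsetP[i ic ->].
have [s1 s2] := component_stable q2 (h x).
have /subsetP/(_ _ ic) : component q1 x \subset h @^-1: component q2 (h x).
  apply: component_sub; last by rewrite inE component_id.
  by split=> j; rewrite !inE => jc; rewrite -(e1, e2); [apply: s1|apply: s2].
by rewrite inE.
Qed.

Lemma perm_onT (T : finType) (s : {perm T}) : perm_on setT s.
Proof. by apply/subsetP=> z _; rewrite inE. Qed.

(** * Replacing a set of edges by a standard one *)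

Section Relabel.
Variables (T : finType) (B : {set T}) (x0 : T).
Hypothesis x0B : x0 \in B.

Let h : 'I_#|B| -> T := enum_val.
Let rk : T -> 'I_#|B| := enum_rank_in x0B.

Let h_inj : injective h. Proof. exact: enum_val_inj. Qed.
Let hB i : h i \in B. Proof. exact: enum_valP. Qed.
Let rkK z : z \in B -> h (rk z) = z. Proof. exact: enum_rankK_in. Qed.
Let hK i : rk (h i) = i. Proof. exact: enum_valK_in. Qed.

Let himg : h @: setT = B.
Proof.
apply/setP=> z; apply/imsetP/idP => [[i _ ->]|zB]; first exact: hB.
by exists (rk z); rewrite ?rkK.
Qed.

Let ext_inj (s : 'S_#|B|) : {in B &, injective (fun z => h (s (rk z)))}.
Proof.
by move=> y z yB zB /h_inj /perm_inj E; rewrite -(rkK yB) E rkK.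
Qed.

Let ext_sub (s : 'S_#|B|) : (fun z => h (s (rk z))) @: B \subset B.
Proof. by apply/subsetP=> _ /imsetP[z _ ->]; apply: hB. Qed.

Let ext (s : 'S_#|B|) : {perm T} := perm_in (@ext_inj s) (ext_sub s).

Let extE s i : ext s (h i) = h (s i).
Proof. by rewrite perm_inE ?hB // hK. Qed.

Let ext_injective : injective ext.
Proof. by move=> s t E; apply/permP=> i; apply: h_inj; rewrite -!extE E. Qed.

(** One inclusion and a count suffice: both sides have [#|B|] factorial elements. *)
Let ext_img : [set t | perm_on B t] = ext @: setT.
Proof.
apply/eqP; rewrite eq_sym eqEcard; apply/andP; split.
  by apply/subsetP=> _ /imsetP[s _ ->]; rewrite inE perm_in_on.
by rewrite card_imset // cardsT card_Sn cardsE card_perm.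
Qed.

Let sum_ext (V : nmodType) (g : {perm T} -> V) :
  \sum_(t | perm_on B t) g t = \sum_s g (ext s).
Proof.
rewrite -big_set ext_img big_imset /=; last by move=> s t _ _; apply: ext_injective.
by apply: eq_bigl => s; rewrite inE.
Qed.

Let conn_ext (q : 'S_#|B| * 'S_#|B|) :
  pair_conn B (ext q.1, ext q.2) = pair_conn setT q.
Proof.
rewrite (pair_conn_component _ (hB (rk x0))) (pair_conn_component _ (in_setT (rk x0))).
suff -> : component (ext q.1, ext q.2) (h (rk x0)) = h @: component q (rk x0).
  by rewrite -[RHS](inj_eq (imset_inj h_inj)) himg.
by apply: component_transport => i; apply: extE.
Qed.

(** Hence [conn_sum B] depends on the size of [B] only: an enumeration of [B] carries permutations,
    connectedness and weights across. *)
Lemma conn_sum_relabel :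
  conn_sum B = conn_sum [set: 'I_#|B|].
Proof.
rewrite /conn_sum /pair_on.
transitivity (\sum_(t | perm_on B t) \sum_(t' | perm_on B t')
    if pair_conn B (t, t') then pair_weight B (t, t') else 0).
  by rewrite big_mkcondr pair_big; apply: eq_big => -[].
rewrite sum_ext; under eq_bigr do rewrite sum_ext.
rewrite pair_big -big_mkcond; apply: eq_big => [q|q _].
  by rewrite conn_ext !perm_onT.
have tr (f : nat -> Qup) (s : 'S_#|B|) (t : {perm T}) : (forall i, t (h i) = h (s i)) ->
    cycle_weight f t B = cycle_weight f s setT.
  by move=> E; rewrite -(cycle_weight_transport h_inj E) himg.
rewrite /pair_weight /=.
by congr (_ * _ * _); apply: tr => i; rewrite ?permM !extE ?permM.
Qed.

End Relabel.

(** * Counting dessins *)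

Section Relabelling.
Variables (m d : nat).
Implicit Types (G : dessin m d) (g : 'S_d).

(** The action of the symmetric group on dessins; isomorphism classes are its orbits and [aut G] is
    the stabilizer. *)
Definition relabel G g : dessin m d :=
  ((white G ^ g)%g, (black G ^ g)%g, [ffun i => g @: lab G i]).

Lemma conj_perm (s g : 'S_d) x : (s ^ g)%g (g x) = g (s x).
Proof. by rewrite conjgE !permM permK. Qed.

Lemma iso_by_relabel g G G' : iso_by g G G' = (relabel G g == G').
Proof.
apply/idP/eqP=> [/and3P[/forallP w /forallP b /forallP l]|<-]; last first.
  apply/and3P; split; apply/forallP=> x; last by rewrite /lab ffunE.
    by rewrite [white (_, _, _)]/white /= conj_perm.
  by rewrite [black (_, _, _)]/black /= conj_perm.
case: G' w b l => [[w' b'] l'] w b l; congr (_, _, _).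
- by apply/permP=> x; rewrite -(permKV g x) conj_perm (eqP (w _)).
- by apply/permP=> x; rewrite -(permKV g x) conj_perm (eqP (b _)).
by apply/ffunP=> i; rewrite ffunE -(eqP (l i)).
Qed.

Lemma pair_conn_relabel G g :
  connected (relabel G g) = connected G.
Proof.
have [T0|[x _]] := set_0Vmem [set: 'I_d].
  by rewrite /connected T0; apply/imsetP/imsetP=> -[x]; rewrite inE.
change (pair_conn setT ((white G ^ g)%g, (black G ^ g)%g) =
  pair_conn setT (white G, black G)).
rewrite (pair_conn_component _ (in_setT (g x))) (pair_conn_component _ (in_setT x)).
rewrite (component_transport (h := g) (q1 := (white G, black G))); last first.
- by move=> i; rewrite conj_perm.
- by move=> i; rewrite conj_perm.
have gT : g @: setT = setT.
  by apply/setP=> z; rewrite inE; apply/imsetP; exists (g^-1%g z); rewrite ?permKV ?inE.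
by rewrite -{1}gT (inj_eq (imset_inj (@perm_inj _ g))).
Qed.

Lemma porbits_conj (s g : 'S_d) :
  porbits (s ^ g)%g = [set g @: o | o : {set 'I_d} in porbits s].
Proof.
have := porbits_transport (@perm_inj _ g) (conj_perm s g) setT.
have gT : g @: setT = setT.
  by apply/setP=> z; rewrite inE; apply/imsetP; exists (g^-1%g z); rewrite ?permKV ?inE.
have E t : [set o in porbits t | o \subset [set: 'I_d]] = porbits t.
  by apply/setP=> o; rewrite inE subsetT andbT.
by rewrite gT !E.
Qed.

Lemma is_dessin_relabel k l mu G g :
  is_dessin k l mu (relabel G g) = is_dessin k l mu G.
Proof.
have gI : injective (fun o : {set 'I_d} => g @: o) := imset_inj (@perm_inj _ g).
rewrite /is_dessin pair_conn_relabel /white /black /lab /= -conjMg !porbits_conj.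
rewrite !(card_imset _ gI).
congr [&& _, _, _, _, _ & _].
- apply/injectiveP/injectiveP=> inj i j.
    by move=> E; apply: inj; rewrite !ffunE E.
  by rewrite !ffunE => /imset_inj - /(_ (@perm_inj _ g)) /inj.
- rewrite -[RHS](inj_eq (imset_inj gI)) -[X in _ = (X == _)]imset_comp; congr (_ == _).
  by apply: eq_imset => i; rewrite ffunE.
by apply: eq_forallb => i; rewrite ffunE card_imset //; apply: perm_inj.
Qed.

(** Orbit-stabilizer: the fibres of [relabel G] are cosets of [aut G]. *)
Lemma card_iso_class G :
  (#|[set G' | iso G G']| * #|aut G|)%N = d`!.
Proof.
rewrite -card_Sn -[RHS]sum1_card (partition_big (relabel G) (iso G)) /=; last first.
  by move=> g _; apply/existsP; exists g; rewrite iso_by_relabel.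
rewrite -sum_nat_const; apply: eq_big => [G'|G' GG']; first by rewrite inE.
move: GG'; rewrite inE => /existsP[g0 Gg0].
rewrite sum1_card -(card_rcoset _ g0); apply: eq_card => g.
rewrite mem_rcoset inE; transitivity (iso_by g G G'); last by rewrite iso_by_relabel.
apply/idP/idP=> [h|h]; last by apply: iso_byM h _; apply: iso_byV.
by rewrite -(mulgKV g0 g); apply: iso_byM h _.
Qed.

End Relabelling.

(** Each class contributes the inverse of [#|aut G|], which by orbit-stabilizer is its size divided
    by $d!$. *)
Lemma N_card (m k l d : nat) (mu : 'I_m -> nat) : (\sum_i mu i)%N = d ->
  N k l mu = #|[set G : dessin m d | is_dessin k l mu G]|%:R / d`!%:R.
Proof.
move=> <-; rewrite /N; set n := (\sum_i mu i)%N; set D := [set _ | _].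
have isoD : {in D & &, equivalence_rel (@iso m n)}.
  by move=> G1 G2 G3 _ _ _; apply: iso_equivalence.
have PD := equivalence_partitionP isoD; set P := equivalence_partition _ D in PD *.
have trX := transversalP PD; set X := transversal P D in trX *.
have n0 : (n`!%:R : rat) != 0 by rewrite pnatr_eq0 -lt0n fact_gt0.
rewrite -sum1_card natr_sum mulr_suml.
transitivity (\sum_(B in P) \sum_(G in B) (n`!%:R : rat)^-1); last first.
  rewrite -(set_partition_big _ PD) /=.
  by apply: eq_bigr => G _; rewrite mul1r.
rewrite -(pblock_transversal trX) [RHS]big_imset /=; last exact: (pblock_inj trX).
apply: eq_bigr => G GX; have GD : G \in D := subsetP (transversal_sub trX) _ GX.
rewrite sumr_const.
(* The block is the full isomorphism class, since being a dessin with the given data is invariant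
   under relabelling. *)
have -> : pblock P G = [set G' | iso G G'].
  apply/setP=> G'; rewrite inE; have [G'D|G'D] := boolP (G' \in D).
    by rewrite (pblock_equivalence_partition isoD).
  apply/idP/idP=> [G'P|/existsP[g]]; last first.
    rewrite iso_by_relabel => /eqP GE; case/negP: G'D.
    by move: GD; rewrite !inE -GE is_dessin_relabel.
  case/negP: G'D; have /and3P[/eqP <- _ _] := PD.
  apply/bigcupP; exists (pblock P G) => //.
  by apply: pblock_mem; case/and3P: PD => /eqP ->.
rewrite -[RHS]mulr_natl; apply: (mulIf n0); rewrite mulfVK //.
rewrite -(card_iso_class G) natrM mulrCA mulVf ?mulr1 //.
by rewrite pnatr_eq0 -lt0n; apply/card_gt0P; exists 1%g; rewrite inE iso_by1.
Qed.

Lemma card_labellings (U : finType) (S : {set U}) m :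
  #|[set f : {ffun 'I_m -> U} | injectiveb f && ([set f i | i : 'I_m] == S)]|
  = if #|S| == m then m`! else 0%N.
Proof.
case: eqP => [Sm|Sm]; last first.
  apply: eq_card0 => f; rewrite inE; apply/negP=> /andP[/injectiveP inj /eqP E].
  by apply: Sm; rewrite -E card_imset // card_ord.
have := card_inj_ffuns_on 'I_m (mem S); rewrite card_ord Sm ffactnn => <-.
apply: eq_card => f.
rewrite !inE andbC; apply: andb_id2r => /injectiveP inj.
apply/eqP/ffun_onP => [<- i|fS]; first exact: imset_f.
apply/eqP; rewrite eqEcard card_imset // card_ord Sm leqnn andbT.
by apply/subsetP=> _ /imsetP[i _ ->].
Qed.

Lemma cycle_weight_const c d (s : 'S_d) :
  cycle_weight (fun=> c : Qup) s setT = c ^+ #|porbits s|.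
Proof. by rewrite cycle_weightT prodr_const. Qed.

(** It removes the summations over the numbers of white and black vertices, every dessin having
    exactly one such pair in range. *)
Lemma sum_nat_pair_eq (V : nmodType) (I : finType) (P : pred I) (a b : I -> nat)
    (w : I -> V) n : (forall i, P i -> (0 < a i < n)%N && (0 < b i < n)%N) ->
  \sum_(1 <= k < n) \sum_(1 <= l < n) \sum_(i | [&& P i, k == a i & l == b i]) w i =
  \sum_(i | P i) w i.
Proof.
move=> ab; transitivity (\sum_(1 <= k < n) \sum_(1 <= l < n) \sum_(i | P i)
    if (k == a i) && (l == b i) then w i else 0).
  by apply: eq_bigr => k _; apply: eq_bigr => l _; rewrite big_mkcondr.
under eq_bigr do rewrite exchange_big /=.
rewrite exchange_big /=; apply: eq_bigr => i /ab /andP[ai bi].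
rewrite (eq_bigr (fun k => if k == a i then w i else 0)) => [|k _].
  by rewrite -big_mkcond /= big_nat1_eq ai.
case: (k == a i) => /=; last by rewrite big1.
by rewrite -big_mkcond /= big_nat1_eq bi.
Qed.

(** * Coefficients of [F] as sums over transitive pairs *)

Section Coefficient.
Variable d : nat.
Hypothesis d0 : (0 < d)%N.

Let x0 : 'I_d := Ordinal d0.

Lemma card_porbits_gt0 (s : 'S_d) : (0 < #|porbits s|)%N.
Proof. by apply/card_gt0P; exists (porbit s x0); apply: mem_porbits. Qed.

Lemma sum_card_porbits (s : 'S_d) : (\sum_(o in porbits s) #|o|)%N = d.
Proof.
rewrite -[RHS]card_ord -sum1_card (partition_big (porbit s) (mem (porbits s))) /=.
  apply: eq_bigr => _ /imsetP[x _ ->]; rewrite -sum1_card; apply: eq_bigl => y.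
  by rewrite eq_porbit_mem.
by move=> y _; apply: mem_porbits.
Qed.

(** The part of [is_dessin], apart from connectedness, that does not depend on [k], [l] and [mu]. *)
Definition labelled m (G : dessin m d) : bool :=
  injectiveb (lab G) && ([set lab G i | i : 'I_m] == porbits (white G * black G)%g).

Definition boundary_lengths m (G : dessin m d) : {ffun 'I_m -> 'I_d.+1} :=
  [ffun i => inord #|lab G i|].

Lemma boundary_lengthsE m (G : dessin m d) i : boundary_lengths G i = #|lab G i| :> nat.
Proof.
by rewrite ffunE inordK // ltnS; have := max_card (lab G i); rewrite card_ord.
Qed.

Lemma is_dessinE m k l (mu : {ffun 'I_m -> 'I_d.+1}) (G : dessin m d) :
  is_dessin k l (fun i => mu i) G =
  [&& connected G && labelled G, k == #|porbits (white G)|,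
      l == #|porbits (black G)| & mu == boundary_lengths G].
Proof.
rewrite /is_dessin /labelled; case: (connected G) => //=.
rewrite (eq_sym k) (eq_sym l); case: (_ == k); case: (_ == l); rewrite ?andbF //=.
rewrite -!andbA; congr [&& _, _ & _].
apply/forallP/eqP=> [h|-> i]; last by rewrite boundary_lengthsE.
by apply/ffunP=> i; apply: val_inj; rewrite /= boundary_lengthsE (eqP (h i)).
Qed.

Lemma big_labelled (V : Type) (idx : V) (op : Monoid.com_law idx)
    (g : {set 'I_d} -> V) m (G : dessin m d) : labelled G ->
  \big[op/idx]_i g (lab G i) = \big[op/idx]_(o in porbits (white G * black G)%g) g o.
Proof.
case/andP=> /injectiveP inj /eqP <-.
by rewrite big_imset //= => i j _ _ /inj.
Qed.

Lemma boundary_lengths_valid m (G : dessin m d) : labelled G ->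
  [forall i, (0 < boundary_lengths G i)%N] && ((\sum_i boundary_lengths G i)%N == d).
Proof.
move=> lG; apply/andP; split.
  apply/forallP=> i; rewrite boundary_lengthsE; case/andP: lG => _ /eqP E.
  have : lab G i \in porbits (white G * black G)%g by rewrite -E imset_f.
  by case/imsetP=> y _ ->; rewrite lt0n card_porbit_neq0.
rewrite (eq_bigr (fun i => #|lab G i|)) => [|i _]; last exact: boundary_lengthsE.
by rewrite (big_labelled _ (fun o => #|o|) lG) sum_card_porbits.
Qed.

Definition dessin_weight m (G : dessin m d) : Qup :=
  pair_weight setT (white G, black G).

Lemma is_dessin_weight m k l (mu : {ffun 'I_m -> 'I_d.+1}) (G : dessin m d) :
    is_dessin k l (fun i => mu i) G ->
  u ^+ k * v ^+ l * \prod_i p (mu i) = dessin_weight G.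
Proof.
rewrite is_dessinE => /and4P[/andP[_ lG] /eqP-> /eqP-> /eqP->].
rewrite /dessin_weight /pair_weight /= !cycle_weight_const; congr (_ * _).
rewrite cycle_weightT -(big_labelled _ (fun o => p #|o|) lG).
by apply: eq_bigr => i _; rewrite boundary_lengthsE.
Qed.

(** A labelled dessin is counted for exactly one [mu], its own [boundary_lengths]. *)
Lemma sum_N m k l :
  \sum_(mu : {ffun 'I_m -> 'I_d.+1}
      | [forall i, (0 < mu i)%N] && ((\sum_i mu i)%N == d))
    N k l (fun i => mu i) *: (u ^+ k * v ^+ l * \prod_i p (mu i)) =
  (d`!%:R : rat)^-1 *: \sum_(G : dessin m d | [&& connected G && labelled G,
      k == #|porbits (white G)| & l == #|porbits (black G)|]) dessin_weight G.
Proof.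
transitivity (\sum_(mu : {ffun 'I_m -> 'I_d.+1}
      | [forall i, (0 < mu i)%N] && ((\sum_i mu i)%N == d))
   \sum_(G : dessin m d | is_dessin k l (fun i => mu i) G)
    (d`!%:R : rat)^-1 *: dessin_weight G).
  apply: eq_bigr => mu /andP[_ /eqP mud].
  rewrite (N_card _ _ mud) mulrC -scalerA scaler_nat -sumr_const.
  rewrite scaler_sumr; apply: eq_big => G; rewrite inE // => Gd.
  by rewrite (is_dessin_weight Gd).
rewrite scaler_sumr.
rewrite (exchange_big_dep (fun G : dessin m d => [&& connected G && labelled G,
      k == #|porbits (white G)| & l == #|porbits (black G)|])) /=; last first.
  by move=> mu G _; rewrite is_dessinE => /and4P[-> -> ->].
apply: eq_bigr => G /and3P[/andP[cG lG] kG lG'].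
rewrite (big_pred1 (boundary_lengths G)) // => mu /=.
rewrite is_dessinE cG lG kG lG' /=.
by apply/andP/eqP=> [[_ /eqP]|->] //; rewrite boundary_lengths_valid // eqxx.
Qed.

Lemma sum_labelled m :
  \sum_(G : dessin m d | connected G && labelled G) dessin_weight G =
  \sum_(q : 'S_d * 'S_d | pair_conn setT q)
    (if #|porbits (q.1 * q.2)%g| == m then m`! else 0%N)%:R * pair_weight setT q.
Proof.
transitivity (\sum_(q : 'S_d * 'S_d | pair_conn setT q)
  \sum_(f : {ffun 'I_m -> {set 'I_d}}
      | injectiveb f && ([set f i | i : 'I_m] == porbits (q.1 * q.2)%g))
    pair_weight setT q).
  by rewrite pair_big_dep /=; apply: eq_big => [[[w b] f]|[[w b] f]].
apply: eq_bigr => q _; rewrite sumr_const mulr_natl; congr (_ *+ _).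
by rewrite -card_labellings; apply: eq_card => f; rewrite inE.
Qed.

(** Summing over [k], [l] and [mu] only sorts connected labelled dessins by vertex numbers and
    boundary lengths, so all of them appear once. *)
Lemma F_conn_sum : F d = (d`!%:R : rat)^-1 *: conn_sum [set: 'I_d].
Proof.
rewrite /F; pose c : rat := (d`!%:R)^-1.
transitivity (\sum_(1 <= m < d.+1) (m`!%:R : rat)^-1 *: (c *:
   \sum_(1 <= k < d.+1) \sum_(1 <= l < d.+1) \sum_(G : dessin m d |
     [&& connected G && labelled G,
      k == #|porbits (white G)| & l == #|porbits (black G)|]) dessin_weight G)).
  under eq_bigr do rewrite exchange_big /=; rewrite exchange_big /=.
  apply: eq_bigr => m _; rewrite !scaler_sumr; apply: eq_bigr => k _.
  rewrite !scaler_sumr; apply: eq_bigr => l _; rewrite sum_N.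
  by rewrite !scaler_sumr.
transitivity (c *: \sum_(1 <= m < d.+1) (m`!%:R : rat)^-1 *:
    \sum_(G : dessin m d | connected G && labelled G) dessin_weight G).
  rewrite scaler_sumr; apply: eq_bigr => m _.
  rewrite scalerA mulrC -scalerA; congr (_ *: (_ *: _)).
  rewrite sum_nat_pair_eq // => G _.
  by rewrite !ltnS !card_porbits_gt0 !card_porbits_le.
rewrite /conn_sum (eq_bigl (pair_conn setT)); last first.
  by move=> q; rewrite /pair_on !perm_onT.
congr (_ *: _).
transitivity (\sum_(1 <= m < d.+1) \sum_(q : 'S_d * 'S_d | pair_conn setT q)
    (m`!%:R : rat)^-1 *: ((if #|porbits (q.1 * q.2)%g| == m then m`! else 0%N)%:R
      * pair_weight setT q)).
  by apply: eq_bigr => m _; rewrite sum_labelled scaler_sumr.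
rewrite exchange_big /=; apply: eq_bigr => q _.
have : (0 < #|porbits (q.1 * q.2)%g| < d.+1)%N.
  by rewrite ltnS card_porbits_gt0 card_porbits_le.
move: #|_| => a ad; rewrite -[RHS]scale1r.
(* For [a] boundary cycles only [m = a] contributes, where the labellings cancel the factorial. *)
transitivity (\sum_(1 <= m < d.+1 | m == a) (1 : rat) *: pair_weight setT q).
  rewrite [RHS]big_mkcond; apply: eq_bigr => m _; rewrite eq_sym.
  case: eqP => _; last by rewrite mul0r scaler0.
  by rewrite mulr_natl -scaler_nat scalerA mulVf ?pnatr_eq0 -?lt0n ?fact_gt0.
by rewrite big_nat1_eq ad.
Qed.

End Coefficient.

(** * Power series *)

(** Low coefficients of powers are those of a truncation, which gives access to the derivative of
    polynomials. *)
Lemma spow_poly (f : series) N j n : (n < N)%N ->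
  spow f j n = ((\poly_(i < N) f i) ^+ j)`_n.
Proof.
elim: j n => [|j IH] n nN; first by rewrite expr0 coef1.
rewrite exprS coefM; apply: eq_bigr => -[i /= i_n] _.
rewrite coef_poly (leq_trans i_n nN); congr (_ * _); apply: IH.
exact: leq_ltn_trans (leq_subr _ _) nN.
Qed.

Lemma spow_eq0 (f : series) j n : f 0%N = 0 -> (n < j)%N -> spow f j n = 0.
Proof.
move=> f0; elim: j n => // j IH n nj; rewrite /spow iterS {1}/smul.
rewrite big1 // => -[[|i] /= i_n] _; first by rewrite f0 mul0r.
by rewrite [X in _ * X]IH ?mulr0 //; lia.
Qed.

Lemma sexpE (f : series) M n : f 0%N = 0 -> (n < M)%N ->
  sexp f n = \sum_(0 <= j < M) (j`!%:R : rat)^-1 *: spow f j n.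
Proof.
move=> f0 nM; rewrite (big_cat_nat _ (n := n.+1)) //= big_mkord.
rewrite [X in _ = _ + X]big_nat [X in _ = _ + X]big1 ?addr0 // => j /andP[nj _].
by rewrite spow_eq0 ?scaler0.
Qed.

(** The coefficient of $s^n$ in $(f^{j+1})' = (j+1) f' f^j$; truncating at degree [n.+2] keeps the
    coefficient of index [n.+1]. *)
Lemma spow_deriv (f : series) j n :
  n.+1%:R * spow f j.+1 n.+1 =
  j.+1%:R * \sum_(i < n.+1) i.+1%:R * f i.+1 * spow f j (n - i)%N.
Proof.
have nN : (n.+1 < n.+2)%N by [].
rewrite (spow_poly _ _ nN) mulr_natl -coef_deriv deriv_exp coefMn -[LHS]mulr_natl.
rewrite coefM. congr (_ * _); apply: eq_bigr => -[i /= i_n] _.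
rewrite coef_deriv coef_poly (_ : (i.+1 < n.+2)%N) // mulr_natl; congr (_ * _).
by rewrite (spow_poly _ (N := n.+2)) //; lia.
Qed.

(** The coefficient form of $(e^f)' = f' e^f$, obtained by differentiating each power. *)
Lemma sexp_deriv (f : series) n : f 0%N = 0 ->
  n.+1%:R * sexp f n.+1 = \sum_(i < n.+1) i.+1%:R * f i.+1 * sexp f (n - i)%N.
Proof.
move=> f0; rewrite (sexpE f0 (ltnSn n.+1)) big_nat_recl // mulrDr.
rewrite /spow /= {1}/sone mulr0n scaler0 mulr0 add0r.
transitivity (\sum_(0 <= j < n.+1) (j`!%:R : rat)^-1 *:
    \sum_(i < n.+1) i.+1%:R * f i.+1 * spow f j (n - i)%N).
  rewrite mulr_sumr; apply: eq_big_nat => j _.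
  rewrite -scalerAr spow_deriv mulr_natl -scaler_nat scalerA; congr (_ *: _).
  by rewrite factS natrM invfM mulrC mulrA mulfV ?mul1r // pnatr_eq0.
rewrite (eq_bigr (fun j => \sum_(i < n.+1) (j`!%:R : rat)^-1 *:
  (i.+1%:R * f i.+1 * spow f j (n - i)%N))); last by move=> j _; rewrite scaler_sumr.
rewrite exchange_big /=.
apply: eq_bigr => -[i /= i_n] _; rewrite (sexpE (M := n.+1) f0); last by lia.
by rewrite mulr_sumr; apply: eq_bigr => j _; rewrite scalerAr.
Qed.

Lemma sexp0 (f : series) : sexp f 0%N = 1.
Proof. by rewrite /sexp big_ord1 /= fact0 invr1 scale1r. Qed.

Lemma F0 : F 0%N = 0.
Proof. by rewrite /F big_geq. Qed.

(** * The exponential formula *)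

Lemma pair_sum0 (T : finType) : pair_sum (set0 : {set T}) = 1.
Proof.
rewrite /pair_sum (big_pred1 (1%g, 1%g)) => [|[w b] /=].
  by rewrite /pair_weight !cycle_weight0 !mulr1.
have on0 (s : {perm T}) : perm_on set0 s = (s == 1%g).
  apply/idP/eqP=> [s0|->]; last by rewrite perm_on1.
  by apply/permP=> z; rewrite perm1 (out_perm s0) ?inE.
by rewrite /pair_on !on0.
Qed.

Lemma sum_subset_card (T : finType) (V : nmodType) (A : {set T}) (g : nat -> V) :
  \sum_(B : {set T} | B \subset A) g #|B| = \sum_(i < #|A|.+1) g i *+ 'C(#|A|, i).
Proof.
rewrite (partition_big (fun B : {set T} => inord #|B| : 'I_#|A|.+1) xpredT) //=.
apply: eq_bigr => i _; rewrite -cards_draws -sumr_const.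
apply: eq_big => [B|B /andP[BA /eqP <-]]; last first.
  by rewrite inordK // ltnS subset_leq_card.
rewrite inE; apply: andb_id2l => BA.
by rewrite -val_eqE /= inordK // ltnS subset_leq_card.
Qed.

Lemma sum_subset_mem (T : finType) (V : nmodType) (A : {set T}) x (g : nat -> V) :
  x \in A ->
  \sum_(B : {set T} | (B \subset A) && (x \in B)) g #|B| =
  \sum_(i < #|A|) g i.+1 *+ 'C(#|A|.-1, i).
Proof.
move=> xA; have cA : #|A| = #|A :\ x|.+1 by rewrite (cardsD1 x) xA.
rewrite cA /= -(sum_subset_card (A :\ x) (fun k => g k.+1)).
rewrite (reindex_onto (fun B => x |: B) (fun B => B :\ x)) /=; last first.
  by move=> B /andP[_ xB]; rewrite setD1K.
apply: eq_big => [B|B /andP[_ /eqP <-]]; last first.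
  by rewrite cardsU1 !inE eqxx.
rewrite setU11 andbT subUset sub1set xA /= subsetD1; congr (_ && _).
by apply/eqP/idP=> [<-|xB]; [rewrite !inE eqxx | rewrite setU1K].
Qed.

(** Both sides satisfy one recurrence: splitting off the component of a point [x] matches the
    coefficients of $(e^F)' = F' e^F$. *)
Lemma pair_sum_sexp (T : finType) (A : {set T}) :
  pair_sum A = ((#|A|)`!%:R : rat) *: sexp F #|A|.
Proof.
have [n] := ubnP #|A|; elim: n A => // n IH A An.
have [->|[x xA]] := set_0Vmem A.
  by rewrite pair_sum0 cards0 sexp0 scale1r.
rewrite (pair_sum_decomp xA).
have [a aE] : {a | #|A| = a.+1}.
  by exists #|A|.-1; rewrite prednK //; apply/card_gt0P; exists x.
(* The contribution of a component of size [k]: the connected sum on it times, by induction, the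
   full sum on its complement. *)
pose g k := ((k`! * (#|A| - k)`!)%:R : rat) *: (F k * sexp F (#|A| - k)%N).
transitivity (\sum_(B : {set T} | (B \subset A) && (x \in B)) g #|B|).
  apply: eq_bigr => B /andP[BA xB].
  have B0 : (0 < #|B|)%N by apply/card_gt0P; exists x.
  have cD : #|A :\: B| = (#|A| - #|B|)%N by rewrite cardsD (setIidPr BA).
  have BAc := subset_leq_card BA.
  rewrite IH ?cD; last by lia.
  rewrite (conn_sum_relabel xB) -scalerAr /g mulnC natrM -scalerA.
  congr (_ *: _); rewrite scalerAl F_conn_sum // scalerA mulfV ?scale1r //.
  by rewrite pnatr_eq0 -lt0n fact_gt0.
rewrite (sum_subset_mem g xA) /g aE /=.
transitivity ((a`!%:R : rat) *: (a.+1%:R * sexp F a.+1)); last first.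
  by rewrite factS mulnC natrM -scalerA mulr_natl -(scaler_nat a.+1 (sexp _ _)).
rewrite sexp_deriv ?F0 //.
rewrite scaler_sumr; apply: eq_bigr => -[i /= i_a] _.
rewrite subSS -mulrA [X in _ = _ *: X]mulr_natl.
rewrite -[LHS]scaler_nat -[X in _ = _ *: X]scaler_nat !scalerA -!natrM.
(* With component size [i.+1], the identity is $(i+1)!\,(a-i)!\binom{a}{i} = a!\,(i+1)$. *)
by congr (_%:R *: _); rewrite factS -(bin_fact (m := i) (n := a)) //; nia.
Qed.

(** * The evolution equation and its unique solution *)

Lemma Qup_natrI n (f g : Qup) : (n.+1)%:R * f = n.+1%:R * g -> f = g.
Proof.
rewrite !mulr_natl -!scaler_nat => /(congr1 (fun z => (n.+1%:R : rat)^-1 *: z)).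
by rewrite !scalerA mulVf ?pnatr_eq0 // !scale1r.
Qed.

Lemma sexp_evol n : sderiv (sexp F) n = evol (sexp F n).
Proof.
(* [A] has [n] points and [ord0] is the new one; the factorials of the exponential formula leave the
   factor [n.+1] of the derivative. *)
pose A := ~: [set ord0 : 'I_n.+1].
have cA : #|A| = n by rewrite cardsC1 card_ord.
have xA : ord0 \notin A by rewrite !inE eqxx.
have := pair_sum_evol xA; rewrite !pair_sum_sexp cardsU1 xA cA evolZ add1n.
rewrite factS natrM mulrC -scalerA => /(congr1 (fun z => (n`!%:R : rat)^-1 *: z)).
rewrite !scalerA mulKf ?mulVf ?pnatr_eq0 -?lt0n ?fact_gt0 //.
by rewrite scale1r scaler_nat -[_ *+ _]mulr_natl.
Qed.

Theorem corollary1 :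
  [/\ F 0%N = 0,
      forall n : nat, sderiv (sexp F) n = evol (sexp F n),
      forall G : series, G 0%N = 0 ->
        (forall n : nat, sderiv (sexp G) n = evol (sexp G n)) ->
        forall n : nat, sexp G n = sexp F n
    & forall n : nat, sexp F n = sexp_op evol n].
Proof.
split=> [||G _ evG n|n]; first exact: F0; first exact: sexp_evol.
  (* The equation determines the coefficient of $s^{n+1}$ from that of $s^n$, and an exponential
     starts with [1]. *)
  elim: n => [|n IH]; first by rewrite !sexp0.
  by apply: (@Qup_natrI n); rewrite -[LHS]/(sderiv (sexp G) n) evG IH -sexp_evol.
elim: n => [|n IH]; first by rewrite sexp0 /sexp_op fact0 invr1 scale1r.
apply: (@Qup_natrI n); rewrite -[LHS]/(sderiv (sexp F) n) sexp_evol IH.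
rewrite /sexp_op evolZ -iterS mulr_natl -scaler_nat scalerA; congr (_ *: _).
by rewrite factS natrM invfM mulrA mulfV ?mul1r // pnatr_eq0.
Qed.
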